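(* Let $A$ be an ordered Banach algebra satisfying Axioms (A$_1$), (A$_2$), (A$_3$), (A$_4$), (A$_5$) and (A$_{\rm LS}'$). Let $a\in A$ be non-zero, order continuous, and irreducible, and let $r(a)$ be a pole of $R(\cdot,a)$. Then the peripheral spectrum $\sigma_{\rm per}(a)$ consists entirely of poles of $R(\cdot,a)$ and has the form $\sigma_{\rm per}(a)=r(a)H_m$ for some $m\in\mathbb N$.
   Context: An ordered Banach algebra is a complex Banach algebra $A$ with unit $\mathbf e\neq0$ and a closed convex cone $A^+$ (closed under sums and multiplication by non-negative reals, $A^+\cap(-A^+)=\{0\}$) such that $\mathbf e\in A^+$ and $ab\in A^+$ for $a,b\in A^+$. Write $a\ge b$ if $a-b\in A^+$, and $a>b$ if $a\ge b$ and $a\ne b$. Spectral notation: $r(a)$ is the spectral radius, $R(\lambda,a)=(\lambda-a)^{-1}$, $\sigma_{\rm per}(a)=\{\lambda\in\sigma(a):|\lambda|=r(a)\}$. A pole of $R(\cdot,a)$ of order $k\ge1$ is an isolated point of $\sigma(a)$ at which the Laurent expansion of $R(\cdot,a)$ has a pole of order $k$. $a_{-1}$ denotes the residue of $R(\cdot,a)$ at $r(a)$. $H_m$ is the group of all $m$-th roots of unity in $\mathbb C$. Order idempotents: ${\bf OI}(A)=\{p\in A:p^2=p,\ 0\le p\le\mathbf e\}$; with the induced order it is a Boolean algebra with $p\wedge q=pq$, $p\vee q=p+q-pq$; put $p^{\rm d}=\mathbf e-p$. An element $a\in A^+$ is order continuous if $p_\alpha a\downarrow0$ and $ap_\alpha\downarrow0$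 in $A$ whenever a net $p_\alpha\downarrow0$ in ${\bf OI}(A)$ ($\downarrow0$: decreasing with infimum $0$ in the indicated ordered set). $A_{\rm n}$ is the set of order continuous elements. $A$ is order regular if $ab\in A_{\rm n}$ for all $a,b\in A_{\rm n}$. $A$ has a disjunctive product if for any $a,b\in A_{\rm n}$ with $ab=0$ there is $p\in{\bf OI}(A)$ with $ap=p^{\rm d}b=0$. An element $a\in A^+$ is irreducible if $p^{\rm d}ap=0$ with $p\in{\bf OI}(A)$ implies $p=0$ or $p=\mathbf e$. $a\gg0$ (algebraically strictly positive) means $p_1ap_2>0$ for all $0<p_1,p_2\in{\bf OI}(A)$. For $b\in A^+$, $A_b=\{y\in A:-\lambda b\le y\le\lambda b\text{ for some real }\lambda\ge0\}$ (the order ideal generated by $b$). $A_{\rm r}=A^+-A^+$. Axioms. (A$_1$): $A$ is order regular and has a disjunctive product, the Boolean algebra ${\bf OI}(A)$ is Dedekind complete, and $A_{\rm n}$ is closed in $A$. (A$_2$): every idempotent $b\gg0$ of $A$ is minimal, i.e. $bAb=\mathbb Cb$. (A$_3$): for every non-zero $b\in A^+$ the order ideal $A_b$ is lattice isomorphic onto a space $C(K)$ of real continuous functions on a compact Hausdorff space $K$, with $b$ mapped to the constant-one function. (A$_4$): $x+iy=0$ with $x,y\in A_{\rm r}$ implies $x=y=0$. (A$_5$): for sequences $(b_n),(c_n)$ in $A_{\rm r}$, (norm) convergence of $(b_n+ic_n)$ implies convergence of $(b_n)$ and of $(c_n)$. (A$_{\rm LS}'$): if $a\in A^+$, $r(a)$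 is a pole of $R(\cdot,a)$, the residue $a_{-1}$ is order continuous, and $a_{-1}\gg0$, then $\sigma_{\rm per}(a)$ consists entirely of poles of $R(\cdot,a)$. *)

(* Defs.v *)
(* The complex field is [R[i]], for an arbitrary [R : realType]. *)
From HB Require Import structures.
From mathcomp Require Export all_boot all_order all_algebra.
From mathcomp Require Export all_classical all_reals all_analysis.
From mathcomp Require Export complex.

Set Implicit Arguments.
Unset Strict Implicit.
Unset Printing Implicit Defensive.

Export Order.TTheory GRing.Theory Num.Theory numFieldNormedType.Exports.

Local Open Scope classical_set_scope.
Local Open Scope ring_scope.
Local Open Scope complex_scope.

(* Ordered complex Banach algebras.  A structure joining [normedModType] with
   rings or orders cannot be added to the hierarchy, since [numDomainType] is
   already the join of these; hence a record, whose carrier [oba_sort] is given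
   all the structures below.  The norm of the unit is not required to be 1. *)
Record orderedBanachAlgebra (R : realType) := OrderedBanachAlgebra {
  oba_base : completeNormedModType R[i];
  oba_one : oba_base;
  oba_mul : oba_base -> oba_base -> oba_base;
  oba_pos : set oba_base;
  oba_mulA : associative oba_mul;
  oba_mul1l : left_id oba_one oba_mul;
  oba_mul1r : right_id oba_one oba_mul;
  oba_mulDl : left_distributive oba_mul +%R;
  oba_mulDr : right_distributive oba_mul +%R;
  oba_scaleAl : forall (z : R[i]) x y, z *: oba_mul x y = oba_mul (z *: x) y;
  oba_scaleAr : forall (z : R[i]) x y, z *: oba_mul x y = oba_mul x (z *: y);
  oba_one_neq0 : oba_one != 0;
  oba_normM : forall x y, `|oba_mul x y| <= `|x| * `|y|;
  oba_pos_closed : closed oba_pos;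
  oba_posD : forall x y, oba_pos x -> oba_pos y -> oba_pos (x + y);
  oba_posZ : forall (l : R) x, 0 <= l -> oba_pos x -> oba_pos (l%:C *: x);
  oba_pos_proper : oba_pos `&` [set - x | x in oba_pos] = [set 0];
  oba_pos1 : oba_pos oba_one;
  oba_posM : forall x y, oba_pos x -> oba_pos y -> oba_pos (oba_mul x y)
}.

Definition oba_sort (R : realType) (A : orderedBanachAlgebra R) : Type :=
  oba_base A.
Coercion oba_sort : orderedBanachAlgebra >-> Sortclass.

Section Instances.
Context (R : realType) (A : orderedBanachAlgebra R).

HB.instance Definition _ := CompleteNormedModule.copy A (oba_base A).

HB.instance Definition _ := GRing.Zmodule_isNzRing.Build A
  (@oba_mulA R A) (@oba_mul1l R A) (@oba_mul1r R A) (@oba_mulDl R A)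
  (@oba_mulDr R A) (@oba_one_neq0 R A).

HB.instance Definition _ :=
  GRing.Lmodule_isLalgebra.Build R[i] A (@oba_scaleAl R A).

HB.instance Definition _ :=
  GRing.Lalgebra_isAlgebra.Build R[i] A (@oba_scaleAr R A).

(* Units are the two-sided invertible elements, decided classically. *)
Let inverses (x : A) : set A := [set y | y * x = 1 /\ x * y = 1].

Let unit : pred A := fun x => `[< exists y, inverses x y >].

Let inv (x : A) : A := xget x (inverses x).

Let inv_spec x : x \in unit -> inverses x (inv x).
Proof. by move=> /asboolP[y xy]; apply: (xgetPex x); exists y. Qed.

Let mulVx : {in unit, left_inverse 1 inv *%R}.
Proof. by move=> x /inv_spec[]. Qed.

Let mulxV : {in unit, right_inverse 1 inv *%R}.
Proof. by move=> x /inv_spec[]. Qed.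

Let unitP (x y : A) : y * x = 1 /\ x * y = 1 -> x \in unit.
Proof. by move=> xy; apply/asboolP; exists y. Qed.

Let inv_out : {in [predC unit], inv =1 id}.
Proof.
move=> x /negP xU; rewrite /inv; case: xgetP => // y _ xy.
by case: xU; apply/asboolP; exists y.
Qed.

HB.instance Definition _ :=
  GRing.NzRing_hasMulInverse.Build A mulVx mulxV unitP inv_out.

Let le (x y : A) : bool := `[< @oba_pos R A (y - x) >].

Let le_refl : reflexive le.
Proof.
move=> x; apply/asboolP; rewrite subrr.
by have [_ /(_ 0 erefl)[]] := (seteqP _ _).1 (@oba_pos_proper R A).
Qed.

Let le_anti : antisymmetric le.
Proof.
move=> x y /andP[/asboolP xy /asboolP yx]; apply/eqP; rewrite -subr_eq0.
have [+ _] := (seteqP _ _).1 (@oba_pos_proper R A).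
move/(_ (x - y)) => /= ->//; split=> //; exists (y - x) => //.
exact: opprB.
Qed.

Let le_trans : transitive le.
Proof.
move=> y x z /asboolP xy /asboolP yz; apply/asboolP.
by have := oba_posD yz xy; rewrite addrA subrK.
Qed.

HB.instance Definition _ :=
  Order.Le_isPOrder.Build ring_display A le_refl le_anti le_trans.

End Instances.

Lemma oba_leE (R : realType) (A : orderedBanachAlgebra R) (x y : A) :
  (x <= y) = `[< @oba_pos R A (y - x) >].
Proof. by []. Qed.

Section Spectrum.
Context (R : realType) (A : orderedBanachAlgebra R).
Implicit Types (a : A) (f : R[i] -> A) (u : int -> A).

Definition spectrum a : set R[i] := [set z | z%:A - a \isn't a GRing.unit].

(* The norm of R[i] takes its values in the reals of R[i], whence [complex.Re]. *)
Definition spectral_radius a : R := sup [set complex.Re `|z| | z in spectrum a].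

Definition peripheral_spectrum a : set R[i] :=
  [set z | spectrum a z /\ `|z| = (spectral_radius a)%:C].

(* Meaningful for z outside the spectrum only. *)
Definition resolvent a (z : R[i]) : A := (z%:A - a)^-1.

Definition laurent_sum u (z0 z : R[i]) (s : A) : Prop :=
  exists v w : A,
    [/\ series (fun n : nat => (z - z0) ^+ n *: u n%:Z) @ \oo --> v,
        series (fun n : nat => (z - z0) ^- n.+1 *: u (- n.+1%:Z)) @ \oo --> w
      & s = v + w].

Definition laurent_expansion f (z0 : R[i]) u : Prop :=
  \forall z \near (z0 : R[i]^o)^', laurent_sum u z0 z (f z).

(* The coefficient u (- 1) does not depend on the choice of u, Laurent expansions
   being unique. *)
Definition residue f (z0 : R[i]) : A :=
  xget 0 [set x | exists2 u, laurent_expansion f z0 u & x = u (- 1)].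

Definition resolvent_pole_of_order a (z0 : R[i]) (k : nat) : Prop :=
  isolated (spectrum a : set R[i]^o) z0 /\
  exists u, [/\ laurent_expansion (resolvent a) z0 u, u (- k%:Z) != 0
              & forall n : int, n < - k%:Z -> u n = 0].

Definition resolvent_pole a (z0 : R[i]) : Prop :=
  exists2 k : nat, (1 <= k)%N & resolvent_pole_of_order a z0 k.

End Spectrum.

(* Suprema and infima of S computed in the ordered subset D. *)
Definition sup_in d (T : porderType d) (D S : set T) (s : T) : Prop :=
  (D `&` ubound S) s /\ lbound (D `&` ubound S) s.

Definition inf_in d (T : porderType d) (D S : set T) (s : T) : Prop :=
  (D `&` lbound S) s /\ ubound (D `&` lbound S) s.

Definition dedekind_complete d (T : porderType d) (D : set T) : Prop :=
  forall S : set T, S `<=` D -> S !=set0 -> D `&` ubound S !=set0 ->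
    exists s, sup_in D S s.

Definition directed (I : Type) (leI : I -> I -> Prop) : Prop :=
  [/\ inhabited I, (forall i, leI i i),
      (forall i j k, leI i j -> leI j k -> leI i k)
    & forall i j, exists k, leI i k /\ leI j k].

(* The net p decreases, with infimum m, in the ordered subset D. *)
Definition decreases_to d (T : porderType d) (D : set T)
    (I : Type) (leI : I -> I -> Prop) (p : I -> T) (m : T) : Prop :=
  [/\ (forall i, D (p i)), (forall i j, leI i j -> (p j <= p i)%O)
    & inf_in D (range p) m].

Section OrderedBanachAlgebraTheory.
Context (R : realType) (A : orderedBanachAlgebra R).
Implicit Types (a b p q x y : A).

Definition OI : set A := [set p : A | p * p = p /\ 0 <= p <= 1].

Definition order_continuous a : Prop :=
  0 <= a /\
  forall (I : Type) (leI : I -> I -> Prop) (p : I -> A), directed leI ->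
    decreases_to OI leI p 0 ->
    decreases_to setT leI (fun i => p i * a) 0 /\
    decreases_to setT leI (fun i => a * p i) 0.

Definition order_regular : Prop :=
  forall a b, order_continuous a -> order_continuous b ->
    order_continuous (a * b).

Definition disjunctive_product : Prop :=
  forall a b, order_continuous a -> order_continuous b -> a * b = 0 ->
    exists2 p, OI p & a * p = 0 /\ (1 - p) * b = 0.

Definition irreducible a : Prop :=
  0 <= a /\ forall p, OI p -> (1 - p) * a * p = 0 -> p = 0 \/ p = 1.

Definition strictly_positive a : Prop :=
  forall p q, OI p -> OI q -> 0 < p -> 0 < q -> 0 < p * a * q.

Definition order_ideal b : set A :=
  [set y : A | exists2 l : R, 0 <= l & - (l%:C *: b) <= y <= l%:C *: b].

Definition regular_part : set A :=
  [set z : A | exists x y : A, [/\ 0 <= x, 0 <= y & z = x - y]].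

(* f is an isomorphism of real vector lattices from [order_ideal b] onto C(K),
   mapping b to 1; in particular [order_ideal b] is a lattice. *)
Definition lattice_iso_CK b (K : topologicalType) (f : A -> K -> R) : Prop :=
  [/\ set_bij (order_ideal b) [set g : K -> R | continuous g] f,
      (forall (l : R) x y, order_ideal b x -> order_ideal b y ->
         f (l%:C *: x + y) = (fun t => l * f x t + f y t)),
      (forall x y, order_ideal b x -> order_ideal b y ->
         exists2 s, sup_in (order_ideal b) [set x; y] s &
                    f s = (fun t => Num.max (f x t) (f y t))),
      (forall x y, order_ideal b x -> order_ideal b y ->
         exists2 s, inf_in (order_ideal b) [set x; y] s &
                    f s = (fun t => Num.min (f x t) (f y t)))
    & f b = (fun=> 1)].

Definition axiom_A1 : Prop :=
  [/\ order_regular, disjunctive_product, dedekind_complete OI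
    & closed [set a | order_continuous a]].

Definition axiom_A2 : Prop :=
  forall b, b * b = b -> strictly_positive b ->
    [set b * x * b | x in [set: A]] = [set z *: b | z in [set: R[i]]].

Definition axiom_A3 : Prop :=
  forall b, 0 <= b -> b != 0 ->
    exists (K : topologicalType) (f : A -> K -> R),
      [/\ compact [set: K], hausdorff_space K & lattice_iso_CK b f].

Definition axiom_A4 : Prop :=
  forall x y, regular_part x -> regular_part y -> x + 'i *: y = 0 ->
    x = 0 /\ y = 0.

Definition axiom_A5 : Prop :=
  forall b c : nat -> A,
    (forall n, regular_part (b n)) -> (forall n, regular_part (c n)) ->
    cvgn (fun n => b n + 'i *: c n) -> cvgn b /\ cvgn c.

Definition axiom_ALS' : Prop :=
  forall a, 0 <= a -> resolvent_pole a (spectral_radius a)%:C ->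
    order_continuous (residue (resolvent a) (spectral_radius a)%:C) ->
    strictly_positive (residue (resolvent a) (spectral_radius a)%:C) ->
    forall z, peripheral_spectrum a z -> resolvent_pole a z.

End OrderedBanachAlgebraTheory.

Arguments OI {R} A.
Arguments order_regular {R} A.
Arguments disjunctive_product {R} A.
Arguments regular_part {R} A.
Arguments axiom_A1 {R} A.
Arguments axiom_A2 {R} A.
Arguments axiom_A3 {R} A.
Arguments axiom_A4 {R} A.
Arguments axiom_A5 {R} A.
Arguments axiom_ALS' {R} A.

(* Main.v *)
Require Import Defs.
From mathcomp Require Import zify ring lra.

(** Write r for the spectral radius of a.  If r = 0 the peripheral spectrum is
    the single point 0.  Let r > 0, and let b be the leading Laurent
    coefficient of the resolvent at r.

    - The coefficient b is positive, order continuous and nonzero, and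
      a b = b a = r b.  Since a is irreducible, this forces b to be strictly
      positive (irreducible_strictly_positive); then b b <> 0, so that the pole
      at r is simple and b is an idempotent, namely the residue
      (spectral_projection).  The Lotz-Schaefer axiom now makes every
      peripheral point a pole.

    - For |z| > r the element R(z, a) is dominated by R(|z|, a)
      (dominated_resolvent).  Approaching a peripheral point r t radially, one
      finds that the leading coefficient c at r t is dominated by b if that pole
      is simple, and by 0 otherwise; so the pole is simple, c = x + iy with
      - b <= x, y <= b, and a c = c a = r t c (peripheral_coefficient, dominated_parts).

    - Identify the order ideal of b with C(K), where b becomes 1.  Left and right
      multiplication by a / r are positive operators fixing 1, and c is an
      eigenfunction of both for the eigenvalue t.  The Cauchy-Schwarz inequality
      gives a h >= r h and h a >= r h for h = x^2 + y^2.  Multiplication by b on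
      both sides annihilates the differences, and b is strictly positive, so
      these are equalities; hence h = b h b, which is a multiple of b by the
      minimality of b.  Thus |c| is constant, and t is an eigenvalue with a
      unimodular eigenfunction (peripheral_unimodular).

    - A unimodular eigenfunction u of a Markov operator S, with unimodular
      eigenvalue, satisfies S (u g) = (S u) (S g) for every g
      (state_eigen_mult).  So products and conjugates of such eigenfunctions are
      again eigenfunctions, and the set of all t with r t in the spectrum and
      |t| = 1 is a group.  As r is isolated in the spectrum, 1 is isolated in
      this group, which is therefore finite, and consists of all m-th roots of
      unity for m its order. *)

Set Implicit Arguments.
Unset Strict Implicit.
Unset Printing Implicit Defensive.

Local Open Scope classical_set_scope.
Local Open Scope ring_scope.
Local Open Scope complex_scope.

(** * Real-valued norms and Neumann series *)

Section RealNorm.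
Context (R : realType).

(** Norms over [R[i]] are elements of [R[i]], whose order is partial; estimates are
    done with their real parts, in the totally ordered field [R]. *)
Definition nmc (z : R[i]) : R := complex.Re `|z|.

Definition nrm (V : normedModType R[i]) (x : V) : R := complex.Re `|x|.

Lemma nrmE (V : normedModType R[i]) (x : V) : `|x| = (nrm x)%:C.
Proof.
rewrite /nrm; have := normr_ge0 x.
by case: `|x| => s t /=; rewrite lecE /= => /andP[/eqP -> _].
Qed.

Context (V : normedModType R[i]).
Implicit Types (x y : V) (z : R[i]) (u : nat -> V).

Lemma nrm_ge0 x : 0 <= nrm x.
Proof. by rewrite -ler0c -nrmE normr_ge0. Qed.

Lemma nrm0 : nrm (0 : V) = 0.
Proof. by rewrite /nrm normr0. Qed.

Lemma nrm_eq0 x : nrm x = 0 -> x = 0.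
Proof. by move=> x0; apply/normr0_eq0; rewrite nrmE x0. Qed.

Lemma nrmD x y : nrm (x + y) <= nrm x + nrm y.
Proof. by rewrite -lecR rmorphD /= -!nrmE ler_normD. Qed.

Lemma nrmN x : nrm (- x) = nrm x.
Proof. by rewrite /nrm normrN. Qed.

Lemma nrmB x y : nrm (x - y) = nrm (y - x).
Proof. by rewrite /nrm distrC. Qed.

Lemma nrmZ z x : nrm (z *: x) = nmc z * nrm x.
Proof.
have : `|z *: x| = `|z| * `|x| := normrZ z x.
rewrite (nrmE x) nrmE -[`|z|](nrmE (z : R[i]^o)) -rmorphM.
by move=> /(congr1 (@complex.Re R)).
Qed.

Lemma nrm_sum (I : Type) (s : seq I) (P : pred I) (F : I -> V) :
  nrm (\sum_(i <- s | P i) F i) <= \sum_(i <- s | P i) nrm (F i).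
Proof.
elim/big_ind2 : _ => [|x1 x2 y1 y2 h1 h2|//]; first by rewrite nrm0.
exact: le_trans (nrmD _ _) (lerD _ _).
Qed.

Lemma cvg_nrmP u x :
  u @ \oo --> x <-> (fun n => nrm (u n - x)) @ \oo --> (0 : R).
Proof.
split=> [/cvgrPdist_lt ux|/cvgrPdist_lt ux].
  apply/cvgrPdist_lt => e e0; have /ux : 0 < e%:C by rewrite ltcR.
  apply: filterS => n; rewrite nrmE ltcR => h.
  by rewrite /= sub0r normrN ger0_norm ?nrm_ge0 // nrmB.
apply/cvgrPdist_lt => -[e e']; rewrite ltcE /= => /andP[/eqP -> e0].
have := ux _ e0; apply: filterS => n /=.
rewrite sub0r normrN ger0_norm ?nrm_ge0 // nrmB => h.
by rewrite nrmE ltcR.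
Qed.

Lemma cvg_nrm_le u x (v : nat -> R) :
  v @ \oo --> (0 : R) -> (\forall n \near \oo, nrm (u n - x) <= v n) ->
  u @ \oo --> x.
Proof.
move=> v0 uv; apply/cvg_nrmP; apply: (squeeze_cvgr _ (cvg_cst 0) v0).
by apply: filterS uv => n /= ->; rewrite nrm_ge0.
Qed.

Lemma cvg_seq_unique u x y : u @ \oo --> x -> u @ \oo --> y -> x = y.
Proof. by move=> ux uy; apply: (cvg_unique _ ux uy); apply: norm_hausdorff. Qed.

Lemma geometric_majorant_tail (v : nat -> V) (C q : R) m k : 0 <= q -> q < 1 ->
  (forall i, nrm (v i) <= C * q ^+ i) ->
  nrm (\sum_(m <= i < m + k) v i) <= C / (1 - q) * q ^+ m.
Proof.
move=> q0 q1 vC.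
have C0 : 0 <= C.
  by have := vC 0; rewrite expr0 mulr1; apply: le_trans; apply: nrm_ge0.
have q1' : 0 < 1 - q by rewrite subr_gt0.
apply: (le_trans (nrm_sum _ _ _)).
rewrite mulrAC ler_pdivlMr //.
apply: (@le_trans _ _ (C * (q ^+ m - q ^+ (m + k)))); last first.
  by rewrite ler_wpM2l // gerBl exprn_ge0.
elim: k => [|k IH]; first by rewrite addn0 big_geq // mul0r subrr mulr0.
rewrite addnS big_nat_recr ?leq_addr //= mulrDl.
have := ler_wpM2r (ltW q1') (vC (m + k)%N).
move=> /(lerD IH) /le_trans; apply.
rewrite exprS le_eqVlt; apply/orP; left; apply/eqP; ring.
Qed.

End RealNorm.

Lemma cvg_geometric_majorant (R : realType) (C q : R) : 0 <= q -> q < 1 ->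
  (fun n => C * q ^+ n) @ \oo --> (0 : R).
Proof.
move=> q0 q1; have -> : (0 : R) = C * 0 by rewrite mulr0.
by apply: cvgM; [apply: cvg_cst|apply: cvg_expr; rewrite ger0_norm].
Qed.

Lemma geometric_majorant_cvg (R : realType) (V : completeNormedModType R[i])
  (v : nat -> V) (C q : R) : 0 <= q -> q < 1 ->
  (forall i, nrm (v i) <= C * q ^+ i) ->
  exists y : V, (fun n => \sum_(0 <= i < n) v i) @ \oo --> y.
Proof.
move=> q0 q1 vC; set u := fun n => \sum_(0 <= i < n) v i.
suff : cvgn u by move=> h; exists (lim (u @ \oo)).
apply/cauchy_cvgP/cauchyP => -[e e']; rewrite ltcE /= => /andP[/eqP -> e0].
have /cvgrPdist_lt/(_ _ e0)[M _ /(_ M (leqnn M))] :=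
  cvg_geometric_majorant (C / (1 - q)) q0 q1.
rewrite /= sub0r normrN => /(le_lt_trans (ler_norm _)) Me.
exists (u M); near=> n; rewrite -ball_normE /= distrC nrmE ltcR.
have /subnKC nM : (M <= n)%N by near: n; exists M.
rewrite /u [X in nrm (X - _)](big_cat_nat _ (n := M)) ?leq0n //=; last first.
  by near: n; exists M.
rewrite [X in nrm (X - _)]addrC addrK -nM.
exact: le_lt_trans (geometric_majorant_tail _ _ q0 q1 vC) Me.
Unshelve. all: by end_near. Qed.

Section ScalarNorm.
Context (R : realType).
Implicit Types (z w : R[i]) (x : R).

Lemma nmcE z : `|z| = (nmc z)%:C.
Proof. exact: (nrmE (z : R[i]^o)). Qed.

Lemma nmc_ge0 z : 0 <= nmc z.
Proof. exact: (nrm_ge0 (z : R[i]^o)). Qed.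

Lemma nmcM z w : nmc (z * w) = nmc z * nmc w.
Proof. exact: (nrmZ z (w : R[i]^o)). Qed.

Lemma nmcX z n : nmc (z ^+ n) = nmc z ^+ n.
Proof.
by have := nmcE (z ^+ n); rewrite normrX nmcE -rmorphXn => /(congr1 (@complex.Re R)).
Qed.

Lemma nmcV z : nmc z^-1 = (nmc z)^-1.
Proof.
have := nmcE z^-1; rewrite normfV nmcE -fmorphV.
by move=> /(congr1 (@complex.Re R)).
Qed.

Lemma nmcR x : nmc x%:C = `|x|.
Proof. by rewrite /nmc normc_def /= expr0n addr0 sqrtr_sqr. Qed.

Lemma nmc_eq0 z : (nmc z == 0) = (z == 0).
Proof.
apply/eqP/eqP => [|->]; last by rewrite /nmc normr0.
exact: (nrm_eq0 (x := (z : R[i]^o))).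
Qed.

Lemma ler_Re_nmc z : `|complex.Re z| <= nmc z.
Proof.
case: z => s t; rewrite /nmc normc_def /= -sqrtr_sqr ler_wsqrtr //.
by rewrite lerDl sqr_ge0.
Qed.

Lemma ler_Im_nmc z : `|complex.Im z| <= nmc z.
Proof.
case: z => s t; rewrite /nmc normc_def /= -sqrtr_sqr ler_wsqrtr //.
by rewrite lerDr sqr_ge0.
Qed.

Lemma nmc_sqr z : nmc z ^+ 2 = complex.Re z ^+ 2 + complex.Im z ^+ 2.
Proof.
by case: z => s t; rewrite /nmc normc_def /= sqr_sqrtr ?addr_ge0 ?sqr_ge0.
Qed.

End ScalarNorm.

Section BanachAlgebra.
Context (R : realType) (A : orderedBanachAlgebra R).
Implicit Types (x y : A) (u v : nat -> A).

Lemma nrmM x y : nrm (x * y) <= nrm x * nrm y.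
Proof. by rewrite -lecR rmorphM /= -!nrmE; apply: oba_normM. Qed.

Lemma cvg_mul u v x y : u @ \oo --> x -> v @ \oo --> y ->
  (fun n => u n * v n) @ \oo --> x * y.
Proof.
move=> ux vy; have vy' := vy; move: ux vy => /cvg_nrmP ux /cvg_nrmP vy.
pose w n := nrm (u n - x) * (nrm (v n - y) + nrm y) + nrm x * nrm (v n - y).
apply: (@cvg_nrm_le _ _ _ _ w).
  have -> : (0 : R) = 0 * (0 + nrm y) + nrm x * 0.
    by rewrite mul0r mulr0 addr0.
  apply: cvgD; last by apply: cvgM => //; apply: cvg_cst.
  by apply: cvgM => //; apply: cvgD => //; apply: cvg_cst.
apply: nearW => n; rewrite /w.
have -> : u n * v n - x * y = (u n - x) * v n + x * (v n - y).
  by rewrite mulrBl mulrBr addrA subrK.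
apply: (le_trans (nrmD _ _)); apply: lerD; last exact: nrmM.
apply: (le_trans (nrmM _ _)); apply: ler_wpM2l; first exact: nrm_ge0.
by rewrite -{1}(subrK y (v n)); apply: nrmD.
Qed.

Lemma geometric_telescope x n : (1 - x) * (\sum_(i < n) x ^+ i) = 1 - x ^+ n.
Proof.
elim: n => [|n IH]; first by rewrite big_ord0 mulr0 expr0 subrr.
by rewrite big_ord_recr /= mulrDr IH mulrBl mul1r -exprS addrA subrK.
Qed.

Lemma geometric_telescope' x n : (\sum_(i < n) x ^+ i) * (1 - x) = 1 - x ^+ n.
Proof.
elim: n => [|n IH]; first by rewrite big_ord0 mul0r expr0 subrr.
by rewrite big_ord_recr /= mulrDl IH mulrBr mulr1 -exprSr addrA subrK.
Qed.

Lemma nrmX x n : nrm (x ^+ n.+1) <= nrm x ^+ n.+1.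
Proof.
elim: n => [//|n IH]; rewrite exprS [in leRHS]exprS.
apply: (le_trans (nrmM _ _)); apply: ler_wpM2l => //; exact: nrm_ge0.
Qed.

Lemma powers_cvg0 x : nrm x < 1 -> (fun n => x ^+ n) @ \oo --> (0 : A).
Proof.
move=> x1; rewrite -cvg_shiftS.
apply: (@cvg_nrm_le _ _ _ _ (fun n => nrm x ^+ n.+1)).
  rewrite (cvg_shiftS (fun n => nrm x ^+ n)).
  by apply: cvg_expr; rewrite ger0_norm ?nrm_ge0.
by apply: nearW => n; rewrite subr0 nrmX.
Qed.

Lemma geometric_cvg x : nrm x < 1 ->
  exists y : A, (fun n => \sum_(0 <= i < n) x ^+ i) @ \oo --> y.
Proof.
move=> x1; apply: (@geometric_majorant_cvg _ _ _ (1 + nrm (1 : A)) (nrm x)).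
- exact: nrm_ge0.
- exact: x1.
- move=> [|i]; first by rewrite !expr0 mulr1 ler_wpDl.
  apply: (le_trans (nrmX _ _)); apply: ler_peMl; first by rewrite exprn_ge0 ?nrm_ge0.
  by rewrite lerDl nrm_ge0.
Qed.

Lemma neumann x : nrm x < 1 -> 1 - x \is a GRing.unit /\
  (fun n => \sum_(0 <= i < n) x ^+ i) @ \oo --> (1 - x)^-1.
Proof.
move=> x1; have [y xy] := geometric_cvg x1.
have p1 : (fun n => 1 - x ^+ n) @ \oo --> (1 : A).
  have {2}-> : (1 : A) = 1 - 0 by rewrite subr0.
  by apply: cvgB; [apply: cvg_cst|apply: powers_cvg0].
have yl : y * (1 - x) = 1.
  apply: (cvg_seq_unique (cvg_mul xy (cvg_cst (1 - x)))).
  by under eq_fun do rewrite big_mkord geometric_telescope'.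
have yr : (1 - x) * y = 1.
  apply: (cvg_seq_unique (cvg_mul (cvg_cst (1 - x)) xy)).
  by under eq_fun do rewrite big_mkord geometric_telescope.
have ux : 1 - x \is a GRing.unit by apply/unitrP; exists y.
by split=> //; have -> : (1 - x)^-1 = y by apply: (mulrI ux); rewrite mulrV.
Qed.

End BanachAlgebra.

(** * Resolvent and domination outside the spectral radius *)

Section Resolvent.
Context (R : realType) (A : orderedBanachAlgebra R) (a : A).
Implicit Types (z w : R[i]) (x y : A).

Local Notation r := (spectral_radius a).
Local Notation Rs := (resolvent a).

Lemma resolvent_large z : nrm a < nmc z ->
  z%:A - a \is a GRing.unit /\ Rs z = z^-1 *: (1 - z^-1 *: a)^-1.
Proof.
move=> az; have z0' : 0 < nmc z by apply: le_lt_trans az; apply: nrm_ge0.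
have z0 : z != 0 by rewrite -nmc_eq0 gt_eqF.
have zU : z \is a GRing.unit by rewrite unitfE.
have /neumann[U _] : nrm (z^-1 *: a) < 1.
  by rewrite nrmZ nmcV mulrC ltr_pdivrMr ?mul1r.
rewrite /resolvent; have -> : z%:A - a = z *: (1 - z^-1 *: a).
  by rewrite scalerBr scalerA divff // scale1r.
by rewrite scaler_unit // invrZ.
Qed.

Lemma spectrum_bounded : has_ubound [set complex.Re `|z| | z in spectrum a].
Proof.
exists (nrm a) => _ [z zs <-]; rewrite leNgt; apply/negP => az.
by move/negP: zs; apply; have [] := resolvent_large az.
Qed.

Lemma spectral_radius_ub z : spectrum a z -> nmc z <= r.
Proof. by move=> zs; apply: (ub_le_sup spectrum_bounded); exists z. Qed.

Lemma resolvent_unit z : r < nmc z -> z%:A - a \is a GRing.unit.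
Proof.
move=> rz; apply/negPn/negP => zs.
by have := spectral_radius_ub zs; rewrite leNgt rz.
Qed.

Lemma resolvent_identity z w :
  z%:A - a \is a GRing.unit -> w%:A - a \is a GRing.unit ->
  Rs z = Rs w + (w - z) *: (Rs z * Rs w).
Proof.
move=> zU wU; have -> : (w - z) *: (Rs z * Rs w) =
    Rs z * ((w%:A - a) - (z%:A - a)) * Rs w.
  rewrite opprB addrA subrK -scalerBl.
  by rewrite -scalerAr mulr1 -scalerAl.
by rewrite mulrBr mulVr // mulrBl mul1r mulrK // addrC subrK.
Qed.

Lemma resolvent_perturb z w : w%:A - a \is a GRing.unit ->
  nmc (w - z) * nrm (Rs w) < 1 ->
  z%:A - a \is a GRing.unit /\ Rs z = Rs w * (1 - (w - z) *: Rs w)^-1.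
Proof.
move=> wU small.
have /neumann[U _] : nrm ((w - z) *: Rs w) < 1 by rewrite nrmZ.
have E : z%:A - a = (1 - (w - z) *: Rs w) * (w%:A - a).
  rewrite mulrBl mul1r -scalerAl mulVr // scalerBl opprB.
  by rewrite [RHS]addrC addrA subrK.
by split; [rewrite E unitrMl|rewrite {1}/resolvent E invrM].
Qed.

(** Absorption in the resolvent identity gives a bound free of the norm of the unit,
    which may exceed 1. *)
Lemma resolvent_perturb_norm z w M :
  z%:A - a \is a GRing.unit -> w%:A - a \is a GRing.unit ->
  nrm (Rs w) <= M -> nmc (w - z) * M <= 1 / 2 -> nrm (Rs z) <= 2 * M.
Proof.
move=> zU wU wM zw; have M0 : 0 <= M by apply: le_trans wM; apply: nrm_ge0.
have := nrmD (Rs w) ((w - z) *: (Rs z * Rs w)).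
rewrite -resolvent_identity // nrmZ => h.
have : nmc (w - z) * nrm (Rs z * Rs w) <= nrm (Rs z) * (nmc (w - z) * M).
  rewrite mulrCA ler_wpM2l ?nmc_ge0 //; apply: (le_trans (nrmM _ _)).
  by rewrite ler_wpM2l ?nrm_ge0.
have : nrm (Rs z) * (nmc (w - z) * M) <= nrm (Rs z) * (1 / 2).
  by rewrite ler_wpM2l ?nrm_ge0.
by move=> h1 h2; have := le_trans h (lerD wM (le_trans h2 h1)); lra.
Qed.

End Resolvent.

Section Domination.
Context (R : realType) (A : orderedBanachAlgebra R) (a : A).
Implicit Types (z w : R[i]) (c b : A) (P Q : {poly R[i]}).

Lemma horner_algZ z P : horner_alg a (z *: P) = z *: horner_alg a P.
Proof. by rewrite linearZ -mulr_algl. Qed.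

Definition coef_dominated P Q := forall i, `|P`_i| <= Q`_i.

(** Domination |c| <= b for elements that need not have a modulus.  Through
    polynomials it is stable under products without any loss of constants, which
    bounds on real and imaginary parts would not be; this is what makes the
    Neumann series, and hence the descent along a ray, preserve it. *)
Definition dominated c b := exists P Q : nat -> {poly R[i]},
  [/\ forall n, coef_dominated (P n) (Q n),
      (fun n => horner_alg a (P n)) @ \oo --> c & (fun n => horner_alg a (Q n)) @ \oo --> b].

Lemma coef_dominatedD P1 Q1 P2 Q2 : coef_dominated P1 Q1 ->
  coef_dominated P2 Q2 -> coef_dominated (P1 + P2) (Q1 + Q2).
Proof.
move=> h1 h2 i; rewrite !coefD; apply: (le_trans (ler_normD _ _)).
exact: lerD.
Qed.

Lemma coef_dominatedM P1 Q1 P2 Q2 : coef_dominated P1 Q1 ->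
  coef_dominated P2 Q2 -> coef_dominated (P1 * P2) (Q1 * Q2).
Proof.
move=> h1 h2 i; rewrite !coefM; apply: (le_trans (ler_norm_sum _ _ _)).
by apply: ler_sum => j _; rewrite normrM ler_pM.
Qed.

Lemma coef_dominatedZ z P Q : coef_dominated P Q ->
  coef_dominated (z *: P) ((nmc z)%:C *: Q).
Proof.
by move=> h i; rewrite !coefZ normrM nmcE ler_wpM2l // ler0c nmc_ge0.
Qed.

Lemma coef_dominatedX : coef_dominated 'X 'X.
Proof. by move=> i; rewrite coefX; case: eqP; rewrite ?normr1 ?normr0. Qed.

Lemma coef_dominated1 : coef_dominated 1 1.
Proof. by move=> i; rewrite coef1; case: eqP; rewrite ?normr1 ?normr0. Qed.

Lemma dominatedD c1 b1 c2 b2 :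
  dominated c1 b1 -> dominated c2 b2 -> dominated (c1 + c2) (b1 + b2).
Proof.
move=> [P1 [Q1 [d1 p1 q1]]] [P2 [Q2 [d2 p2 q2]]].
exists (fun n => P1 n + P2 n), (fun n => Q1 n + Q2 n); split.
- by move=> n; apply: coef_dominatedD.
- by under eq_fun do rewrite rmorphD; apply: cvgD.
- by under eq_fun do rewrite rmorphD; apply: cvgD.
Qed.

Lemma dominatedM c1 b1 c2 b2 :
  dominated c1 b1 -> dominated c2 b2 -> dominated (c1 * c2) (b1 * b2).
Proof.
move=> [P1 [Q1 [d1 p1 q1]]] [P2 [Q2 [d2 p2 q2]]].
exists (fun n => P1 n * P2 n), (fun n => Q1 n * Q2 n); split.
- by move=> n; apply: coef_dominatedM.
- by under eq_fun do rewrite rmorphM; apply: cvg_mul.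
- by under eq_fun do rewrite rmorphM; apply: cvg_mul.
Qed.

Lemma cvg_scale_seq z (u : nat -> A) c : u @ \oo --> c ->
  (fun n => z *: u n) @ \oo --> z *: c.
Proof.
move=> /cvg_nrmP uc; apply: (@cvg_nrm_le _ _ _ _ (fun n => nmc z * nrm (u n - c))).
  have -> : (0 : R) = nmc z * 0 by rewrite mulr0.
  by apply: cvgM => //; apply: cvg_cst.
by apply: nearW => n; rewrite -scalerBr nrmZ.
Qed.

Lemma dominatedZ z c b : dominated c b -> dominated (z *: c) ((nmc z)%:C *: b).
Proof.
move=> [P [Q [d p q]]].
exists (fun n => z *: P n), (fun n => (nmc z)%:C *: Q n); split.
- by move=> n; apply: coef_dominatedZ.
- by under eq_fun do rewrite horner_algZ; apply: cvg_scale_seq.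
- by under eq_fun do rewrite horner_algZ; apply: cvg_scale_seq.
Qed.

Lemma dominated1 : dominated 1 1.
Proof.
exists (fun=> 1), (fun=> 1); split; first by move=> _; apply: coef_dominated1.
- by under eq_fun do rewrite rmorph1; apply: cvg_cst.
- by under eq_fun do rewrite rmorph1; apply: cvg_cst.
Qed.

Lemma dominated_gen : dominated a a.
Proof.
exists (fun=> 'X), (fun=> 'X); split; first by move=> _; apply: coef_dominatedX.
- by under eq_fun do rewrite horner_algX; apply: cvg_cst.
- by under eq_fun do rewrite horner_algX; apply: cvg_cst.
Qed.

Lemma dominatedX c b n : dominated c b -> dominated (c ^+ n) (b ^+ n).
Proof.
by move=> d; elim: n => [|n]; [exact: dominated1|rewrite !exprS; apply: dominatedM].
Qed.

Lemma dominated0 : dominated 0 0.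
Proof.
by have := dominatedZ 0 dominated1; rewrite /nmc normr0 /= !scale0r.
Qed.

Lemma dominated_lim (c b : nat -> A) c0 b0 : (forall n, dominated (c n) (b n)) ->
  c @ \oo --> c0 -> b @ \oo --> b0 -> dominated c0 b0.
Proof.
move=> d cc bb.
have key n : exists PQ : {poly R[i]} * {poly R[i]}, [/\ coef_dominated PQ.1 PQ.2,
   nrm (horner_alg a PQ.1 - c n) <= n.+1%:R^-1 &
   nrm (horner_alg a PQ.2 - b n) <= n.+1%:R^-1].
  have [P [Q [dd /cvg_nrmP/cvgrPdist_le p /cvg_nrmP/cvgrPdist_le q]]] := d n.
  have n0 : 0 < n.+1%:R^-1 :> R by rewrite invr_gt0.
  have [m _ /(_ m (leqnn m))] := filterI (p _ n0) (q _ n0).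
  rewrite /= !sub0r !normrN => -[h1 h2].
  by exists (P m, Q m); split=> //=; apply: le_trans (ler_norm _) _.
have [PQ hPQ] := choice key.
exists (fun n => (PQ n).1), (fun n => (PQ n).2); split.
- by move=> n; case: (hPQ n).
- have -> : c0 = 0 + c0 by rewrite add0r.
  rewrite (_ : (fun=> _) = (fun n => (horner_alg a (PQ n).1 - c n) + c n)); last first.
    by apply/funext => n; rewrite subrK.
  apply: cvgD => //; apply: (@cvg_nrm_le _ _ _ _ harmonic); first exact: cvg_harmonic.
  by apply: nearW => n; rewrite subr0; case: (hPQ n).
- have -> : b0 = 0 + b0 by rewrite add0r.
  rewrite (_ : (fun=> _) = (fun n => (horner_alg a (PQ n).2 - b n) + b n)); last first.
    by apply/funext => n; rewrite subrK.
  apply: cvgD => //; apply: (@cvg_nrm_le _ _ _ _ harmonic); first exact: cvg_harmonic.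
  by apply: nearW => n; rewrite subr0; case: (hPQ n).
Qed.

Lemma dominated_neumann c b : dominated c b -> nrm c < 1 -> nrm b < 1 ->
  dominated (1 - c)^-1 (1 - b)^-1.
Proof.
move=> d /neumann[_ hc] /neumann[_ hb]; apply: (dominated_lim _ hc hb) => n.
elim: n => [|n IH]; first by rewrite !big_geq //; apply: dominated0.
by rewrite !big_nat_recr //=; apply: dominatedD => //; apply: dominatedX.
Qed.

Local Notation r := (spectral_radius a).
Local Notation Rs := (resolvent a).

(** For m > |a| compare the Neumann series of both resolvents term by term.  If the
    claim failed for some m > r, let s be the supremum of the failures.  Both
    resolvents are bounded by some 2M near s, so a Neumann expansion about a point
    just above s reaches a fixed distance below s, where a failure remains:
    a contradiction. *)
Lemma dominated_resolvent (t : R[i]) (m : R) : nmc t = 1 -> 0 < m -> r < m ->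
  dominated (Rs (m%:C * t)) (Rs m%:C).
Proof.
move=> t1; have nm (s : R) : 0 < s -> nmc (s%:C * t) = s.
  by move=> s0; rewrite nmcM t1 mulr1 nmcR gtr0_norm.
have nm' (s : R) : 0 < s -> nmc s%:C = s by move=> s0; rewrite nmcR gtr0_norm.
have base (s : R) : 0 < s -> nrm a < s -> dominated (Rs (s%:C * t)) (Rs s%:C).
  move=> s0 as_.
  have /resolvent_large[_ ->] : nrm a < nmc (s%:C * t) by rewrite nm.
  have /resolvent_large[_ ->] : nrm a < nmc s%:C by rewrite nm'.
  have -> : s%:C^-1 = (nmc (s%:C * t)^-1)%:C by rewrite nmcV nm // fmorphV.
  apply: dominatedZ; apply: dominated_neumann.
  - by apply: dominatedZ; apply: dominated_gen.
  - by rewrite nrmZ nmcV nm // mulrC ltr_pdivrMr // mul1r.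
  - by rewrite nrmZ nmcV !nm // nm' ?invr_gt0 // mulrC ltr_pdivrMr // mul1r.
have step (s m' : R) : 0 < m' -> m' <= s -> r < m' ->
    dominated (Rs (s%:C * t)) (Rs s%:C) ->
    (s - m') * nrm (Rs (s%:C * t)) < 1 -> (s - m') * nrm (Rs s%:C) < 1 ->
    dominated (Rs (m'%:C * t)) (Rs m'%:C).
  move=> m0 ms rm d h1 h2.
  have n1 : nmc (s%:C * t - m'%:C * t) = s - m'.
    by rewrite -mulrBl nmcM t1 mulr1 -rmorphB nmcR ger0_norm // subr_ge0.
  have n2 : nmc (s%:C - m'%:C) = s - m'.
    by rewrite -rmorphB nmcR ger0_norm // subr_ge0.
  have s0 := lt_le_trans m0 ms; have rs := lt_le_trans rm ms.
  have U1 : (s%:C * t)%:A - a \is a GRing.unit by apply: resolvent_unit; rewrite nm.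
  have U2 : s%:C%:A - a \is a GRing.unit by apply: resolvent_unit; rewrite nm'.
  have q1 : nmc (s%:C * t - m'%:C * t) * nrm (Rs (s%:C * t)) < 1 by rewrite n1.
  have q2 : nmc (s%:C - m'%:C) * nrm (Rs s%:C) < 1 by rewrite n2.
  have [_ ->] := resolvent_perturb U1 q1; have [_ ->] := resolvent_perturb U2 q2.
  apply: dominatedM => //; apply: dominated_neumann; last 2 first.
  - by rewrite nrmZ n1.
  - by rewrite nrmZ n2.
  have -> : s%:C - m'%:C = (nmc (s%:C * t - m'%:C * t))%:C by rewrite n1 rmorphB.
  exact: dominatedZ.
move=> m0 rm; apply: contrapT => nd.
pose B := [set s : R | [/\ 0 < s, r < s & ~ dominated (Rs (s%:C * t)) (Rs s%:C)]].
have Bub : has_ubound B.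
  exists (nrm a) => s [s0 _ nds]; rewrite leNgt; apply/negP => h.
  by apply: nds; apply: base.
have Bm : B m by [].
have supB : has_sup B by split => //; exists m.
pose s := sup B; have ms : m <= s by apply: ub_le_sup.
have s0 := lt_le_trans m0 ms; have rs := lt_le_trans rm ms.
pose M := nrm (Rs (s%:C * t)) + nrm (Rs s%:C) + 1.
have M0 : 0 < M by rewrite /M ltr_wpDl // addr_ge0 // nrm_ge0.
pose d := (4 * M)^-1; have d0 : 0 < d by rewrite invr_gt0 mulr_gt0.
have dM : d * M = 1 / 4 by rewrite /d; field; rewrite gt_eqF.
have [m' [m0' rm' nd'] sm'] := sup_adherent d0 supB; apply: (nd').
have m's : m' <= s by apply: ub_le_sup.
(* Expand about s', where the claim holds because s' > s; the resolvents there have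
   norm at most 2M, and m' is at distance at most 3d/2 = 3/(8M) from s'. *)
pose s' := s + d / 2.
have ss' : s < s' by rewrite /s' ltrDl divr_gt0.
have s'0 := lt_trans s0 ss'; have rs' := lt_trans rs ss'.
have U1 : (s%:C * t)%:A - a \is a GRing.unit by apply: resolvent_unit; rewrite nm.
have U2 : s%:C%:A - a \is a GRing.unit by apply: resolvent_unit; rewrite nm'.
have U1' : (s'%:C * t)%:A - a \is a GRing.unit by apply: resolvent_unit; rewrite nm.
have U2' : s'%:C%:A - a \is a GRing.unit by apply: resolvent_unit; rewrite nm'.
have n1 : nmc (s%:C * t - s'%:C * t) = d / 2.
  rewrite -mulrBl nmcM t1 mulr1 -rmorphB nmcR /s' opprD addrA subrr sub0r.
  by rewrite normrN gtr0_norm // divr_gt0.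
have n2 : nmc (s%:C - s'%:C) = d / 2.
  rewrite -rmorphB nmcR /s' opprD addrA subrr sub0r.
  by rewrite normrN gtr0_norm // divr_gt0.
have b1 : nrm (Rs (s'%:C * t)) <= 2 * M.
  apply: (resolvent_perturb_norm U1' U1); last by rewrite n1 mulrAC dM; lra.
  by rewrite /M -addrA lerDl addr_ge0 // nrm_ge0.
have b2 : nrm (Rs s'%:C) <= 2 * M.
  apply: (resolvent_perturb_norm U2' U2); last by rewrite n2 mulrAC dM; lra.
  by rewrite /M addrAC lerDr addr_ge0 // nrm_ge0.
have sm2 : s' - m' <= 3 / 2 * d by move: sm'; rewrite -/s /s' => sm'; lra.
have fin x : x <= 2 * M -> (s' - m') * x < 1.
  move=> xM; apply: (@le_lt_trans _ _ ((s' - m') * (2 * M))).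
    by apply: ler_wpM2l => //; rewrite subr_ge0 (le_trans m's) // ltW.
  apply: (@le_lt_trans _ _ (3 / 2 * d * (2 * M))).
    by apply: ler_wpM2r => //; rewrite mulr_ge0 // ltW.
  by rewrite mulrACA -(mulrA 3) [2^-1 * _]mulrC; nra.
apply: (step s') => //; try exact: fin; first exact: le_trans m's (ltW ss').
apply: contrapT => nds'; have : s' <= s by apply: ub_le_sup.
by rewrite leNgt ss'.
Qed.

End Domination.

(** * Order, order continuity and irreducibility *)

Section Order.
Context (R : realType) (A : orderedBanachAlgebra R).
Implicit Types (x y z : A) (l : R).

Lemma opos_sub x y : (x <= y) = (0 <= y - x).
Proof. by rewrite !oba_leE subr0. Qed.

Lemma oposP x : reflect (@oba_pos R A x) (0 <= x).
Proof. by rewrite oba_leE subr0; apply: asboolP. Qed.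

Lemma oposD x y : 0 <= x -> 0 <= y -> 0 <= x + y.
Proof. by move=> /oposP x0 /oposP y0; apply/oposP/oba_posD. Qed.

Lemma oposM x y : 0 <= x -> 0 <= y -> 0 <= x * y.
Proof. by move=> /oposP x0 /oposP y0; apply/oposP/oba_posM. Qed.

Lemma oposZ l x : 0 <= l -> 0 <= x -> 0 <= l%:C *: x.
Proof. by move=> l0 /oposP x0; apply/oposP/oba_posZ. Qed.

Lemma opos1 : 0 <= 1 :> A.
Proof. exact/oposP/oba_pos1. Qed.

Lemma oposX x n : 0 <= x -> 0 <= x ^+ n.
Proof.
by move=> x0; elim: n => [|n IH]; [exact: opos1|rewrite exprS oposM].
Qed.

Lemma oleD x y x' y' : x <= y -> x' <= y' -> x + x' <= y + y'.
Proof.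
rewrite !(opos_sub x) !(opos_sub x') (opos_sub (x + x')) => h h'.
by rewrite opprD addrACA oposD.
Qed.

Lemma oleN x y : x <= y -> - y <= - x.
Proof. by rewrite opos_sub (opos_sub (- y)) opprK addrC. Qed.

Lemma oleM2l z x y : 0 <= z -> x <= y -> z * x <= z * y.
Proof. by rewrite (opos_sub x) (opos_sub (z * x)) -mulrBr; apply: oposM. Qed.

Lemma oleM2r z x y : 0 <= z -> x <= y -> x * z <= y * z.
Proof.
by move=> z0; rewrite (opos_sub x) (opos_sub (x * z)) -mulrBl => h; apply: oposM.
Qed.

Lemma oleZ2 l x y : 0 <= l -> x <= y -> l%:C *: x <= l%:C *: y.
Proof.
by rewrite (opos_sub x) (opos_sub (l%:C *: x)) -scalerBr; apply: oposZ.
Qed.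

Lemma opos_lim (u : nat -> A) x :
  (forall n, 0 <= u n) -> u @ \oo --> x -> 0 <= x.
Proof.
move=> u0 ux; apply/oposP; apply: (closed_cvg _ (@oba_pos_closed R A) _ _ ux).
by apply: nearW => n; apply/oposP.
Qed.

Lemma ole_lim (u v : nat -> A) x y :
  (forall n, u n <= v n) -> u @ \oo --> x -> v @ \oo --> y -> x <= y.
Proof.
move=> uv ux vy; rewrite opos_sub; apply: (opos_lim _ (cvgB vy ux)) => n.
by rewrite -opos_sub.
Qed.

End Order.

Section OrderContinuity.
Context (R : realType) (A : orderedBanachAlgebra R).
Implicit Types (a b c p q x y z : A) (l : R).

Section Nets.
Context (I : Type) (leI : I -> I -> Prop).
Implicit Types u v : I -> A.
Local Notation vanishing u := (decreases_to setT leI u 0).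

Lemma vanishing_squeeze u v : (forall i j, leI i j -> u j <= u i) ->
  (forall i, 0 <= u i <= v i) -> vanishing v -> vanishing u.
Proof.
move=> udec uv [_ vdec [_ vinf]]; split=> //; split.
  by split=> // _ [i _ <-]; case/andP: (uv i).
move=> z [_ zu]; apply: vinf; split=> // _ [i _ <-].
by apply: (@le_trans _ _ (u i)); [apply: zu; exists i|case/andP: (uv i)].
Qed.

Lemma vanishing_ge0 u i : vanishing u -> 0 <= u i.
Proof. by move=> [_ _ [[_ h] _]]; apply: h; exists i. Qed.

(** If z <= u i + v i for all i, then z - v j is a lower bound of u for each j, by
    monotonicity beyond j; so z <= v j for each j. *)
Lemma vanishingD u v : directed leI -> vanishing u -> vanishing v ->
  vanishing (fun i => u i + v i).
Proof.
move=> [_ _ _ dir] hu hv; split=> //.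
- by move=> i j ij; case: hu => _ ? _; case: hv => _ ? _; apply: oleD; auto.
- split; first by split=> // _ [i _ <-]; rewrite oposD ?vanishing_ge0.
move=> z [_ zuv].
case: (hu) (hv) => _ ud [_ uinf] [_ vd [_ vinf]].
apply: vinf; split=> // _ [j _ <-].
suff : z - v j <= 0 by rewrite opos_sub sub0r opprB -opos_sub.
apply: uinf; split=> // _ [i _ <-].
have [k [ik jk]] := dir i j.
have /oleD/(_ (lexx (- v j))) : z <= u k + v k by apply: zuv; exists k.
move/le_trans; apply; rewrite -addrA -[leRHS]addr0; apply: oleD; first exact: ud.
by rewrite opos_sub sub0r opprB -opos_sub; apply: vd.
Qed.

Lemma vanishing_scale l u : directed leI -> 0 <= l -> vanishing u ->
  vanishing (fun i => l%:C *: u i).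
Proof.
move=> [[i0] _ _ _] l0 hu; have [_ ud [_ uinf]] := hu; split=> //.
- by move=> i j ij; apply: oleZ2 => //; apply: ud.
- split; first by split=> // _ [i _ <-]; rewrite oposZ ?vanishing_ge0.
move=> z [_ zlu]; have {l0} : (l == 0) || (0 < l) by rewrite eq_sym -le_eqVlt.
case/orP=> [/eqP l0|l0].
  by have := zlu _ (imageT _ i0); rewrite l0 scale0r.
suff /(oleZ2 (ltW l0)) : (l^-1)%:C *: z <= 0.
  by rewrite scalerA -rmorphM mulfV ?gt_eqF // scale1r scaler0.
apply: uinf; split=> // _ [i _ <-].
have /(oleZ2 (ltW _)) : z <= l%:C *: u i by apply: zlu; exists i.
move=> /(_ l^-1); rewrite invr_gt0 => /(_ l0).
by rewrite scalerA -rmorphM mulVf ?gt_eqF // scale1r.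
Qed.

End Nets.

Lemma OI_ge0 p : OI A p -> 0 <= p.
Proof. by case=> _ /andP[]. Qed.

Lemma OI_le1 p : OI A p -> p <= 1.
Proof. by case=> _ /andP[]. Qed.

Lemma order_continuous_le x b : 0 <= x -> x <= b -> order_continuous b ->
  order_continuous x.
Proof.
move=> x0 xb [b0 bc]; split=> // I leI p dir pd.
have [pb bp] := bc I leI p dir pd; have [pOI pdec _] := pd.
have p0 i := OI_ge0 (pOI i); split.
- apply: vanishing_squeeze pb; first by move=> i j ij; apply: oleM2r => //; apply: pdec.
  by move=> i; rewrite oposM //= oleM2l.
- apply: vanishing_squeeze bp; first by move=> i j ij; apply: oleM2l => //; apply: pdec.
  by move=> i; rewrite oposM //= oleM2r.
Qed.

Lemma order_continuousD x y : order_continuous x -> order_continuous y ->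
  order_continuous (x + y).
Proof.
move=> [x0 xc] [y0 yc]; split; first exact: oposD.
move=> I leI p dir pd; have [px xp] := xc I leI p dir pd.
have [py yp] := yc I leI p dir pd; split.
- by under eq_fun do rewrite mulrDr; apply: vanishingD.
- by under eq_fun do rewrite mulrDl; apply: vanishingD.
Qed.

Lemma order_continuousZ l x : 0 <= l -> order_continuous x ->
  order_continuous (l%:C *: x).
Proof.
move=> l0 [x0 xc]; split; first exact: oposZ.
move=> I leI p dir pd; have [px xp] := xc I leI p dir pd; split.
- by under eq_fun do rewrite -scalerAr; apply: vanishing_scale.
- by under eq_fun do rewrite -scalerAl; apply: vanishing_scale.
Qed.

Lemma order_continuous0 : order_continuous (0 : A).
Proof.
split=> // I leI p [[i0] _ _ _] _.
have h : decreases_to setT leI (fun=> 0 : A) 0.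
  split=> //; split; first by split=> // _ [i _ <-].
  by move=> z [_ /(_ 0)]; apply; exists i0.
by split; [under eq_fun do rewrite mulr0|under eq_fun do rewrite mul0r].
Qed.

(** The factor [a] is essential: the unit, and so a constant term, need not be order
    continuous. *)
Lemma order_continuous_poly a (Q : {poly R[i]}) : order_regular A ->
  order_continuous a -> (forall i, 0 <= Q`_i) ->
  order_continuous (a * horner_alg a Q).
Proof.
move=> reg ac Q0; rewrite -[Q]coefK poly_def raddf_sum mulr_sumr.
apply: (big_ind (@order_continuous R A)) => [||i _]; [exact: order_continuous0|exact: order_continuousD|].
rewrite /= horner_algZ rmorphXn /= horner_algX -scalerAr -exprS.
have := Q0 i; case: Q`_i => s t; rewrite lecE /= => /andP[/eqP -> s0].
apply: order_continuousZ => //.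
by elim: (nat_of_ord i) => [//|n IH]; rewrite exprS; apply: reg.
Qed.

Lemma horner_alg_ge0 a (Q : {poly R[i]}) : 0 <= a -> (forall i, 0 <= Q`_i) ->
  0 <= horner_alg a Q.
Proof.
move=> a0 Q0; rewrite -[Q]coefK poly_def raddf_sum.
apply: (big_ind (fun x : A => 0 <= x)) => [//||i _]; first exact: oposD.
rewrite /= horner_algZ rmorphXn /= horner_algX.
have := Q0 i; case: Q`_i => s t; rewrite lecE /= => /andP[/eqP -> s0].
by apply: oposZ => //; apply: oposX.
Qed.

End OrderContinuity.

Section OrderIdempotents.
Context (R : realType) (A : orderedBanachAlgebra R).
Implicit Types (a b c p q x y z : A) (l : R).

Lemma OI0 : OI A 0.
Proof. by split; rewrite ?mulr0 // lexx opos1. Qed.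

Lemma OI1 : OI A 1.
Proof. by split; rewrite ?mulr1 // lexx opos1. Qed.

Lemma olt01 : 0 < 1 :> A.
Proof. by rewrite lt_def oner_neq0 opos1. Qed.

Lemma OI_complement p : OI A p -> OI A (1 - p).
Proof.
move=> [pp /andP[p0 p1]]; split.
  by rewrite mulrBl mul1r mulrBr mulr1 pp subrr subr0.
by rewrite -opos_sub p1 opos_sub opprB addrC subrK.
Qed.

(** Both p q (1 - p) and (1 - p) q p lie between 0 and p (1 - p) = 0, since
    0 <= q <= 1; so p q = p q p = q p. *)
Lemma OI_comm p q : OI A p -> OI A q -> p * q = q * p.
Proof.
move=> [pp /andP[p0 p1]] [qq /andP[q0 q1]].
have p'0 : 0 <= 1 - p by rewrite -opos_sub.
have e1 : p * q * (1 - p) = 0.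
  apply/le_anti; rewrite oposM ?oposM // andbT.
  have -> : 0 = p * 1 * (1 - p) by rewrite mulr1 mulrBr mulr1 pp subrr.
  by apply: oleM2r => //; apply: oleM2l.
have e2 : (1 - p) * q * p = 0.
  apply/le_anti; rewrite oposM ?oposM // andbT.
  have -> : 0 = (1 - p) * 1 * p by rewrite mulr1 mulrBl mul1r pp subrr.
  by apply: oleM2r => //; apply: oleM2l.
move: e1 e2; rewrite mulrBr mulr1 !mulrBl mul1r.
by move=> /subr0_eq h1 /subr0_eq ->; rewrite -h1.
Qed.

Lemma OI_meet p q : OI A p -> OI A q -> OI A (p * q).
Proof.
move=> hp hq; have pq := OI_comm hp hq.
case: (hp) (hq) => pp /andP[p0 p1] [qq /andP[q0 q1]]; split.
  by rewrite -mulrA (mulrA q) -pq -mulrA qq mulrA pp.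
rewrite oposM //=; apply: le_trans p1.
by rewrite -[leRHS]mulr1; apply: oleM2l.
Qed.

Lemma OI_join p q : OI A p -> OI A q -> OI A (p + q - p * q).
Proof.
move=> hp hq.
have -> : p + q - p * q = 1 - (1 - p) * (1 - q).
  rewrite mulrBl mul1r mulrBr mulr1 !opprB.
  by rewrite [RHS]addrC -[RHS]addrA subrK [RHS]addrAC.
by apply: OI_complement; apply: OI_meet; apply: OI_complement.
Qed.

Lemma OI_le_mull p q : OI A p -> OI A q -> p <= q -> p * q = p.
Proof.
move=> [pp /andP[p0 p1]] [qq /andP[q0 q1]] pq; apply/le_anti/andP; split.
  by rewrite -[leRHS]mulr1; apply: oleM2l.
by rewrite -{1}pp; apply: oleM2l.
Qed.

Lemma OI_le_mulr p q : OI A p -> OI A q -> p <= q -> q * p = p.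
Proof. by move=> hp hq pq; rewrite -OI_comm // OI_le_mull. Qed.

Lemma OI_sub p q : OI A p -> OI A q -> p <= q -> OI A (q - p).
Proof.
move=> hp hq pq; have -> : q - p = (1 - p) * q.
  by rewrite mulrBl mul1r OI_le_mull.
by apply: OI_meet => //; apply: OI_complement.
Qed.

(** The idempotents annihilated by [g] are directed by joins; let s be their supremum.
    The differences s - p decrease to 0, while g (s - p) = g s does not depend on p.
    This is applied to left and to right multiplication by b. *)
Lemma largest_annihilator (g : A -> A) : dedekind_complete (OI A) ->
  {morph g : x y / x - y >-> x - y} -> (forall x, 0 <= x -> 0 <= g x) ->
  (forall (I : Type) (leI : I -> I -> Prop) (p : I -> A), directed leI ->
    decreases_to (OI A) leI p 0 -> decreases_to setT leI (g \o p) 0) ->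
  exists s, [/\ OI A s, g s = 0 & forall p, OI A p -> g p = 0 -> p <= s].
Proof.
move=> ded gB g0 gc.
have g00 : g 0 = 0 by rewrite -[X in g X]subr0 gB subrr.
have gD x y : g (x + y) = g x + g y.
  by rewrite -[y in LHS]opprK gB -[- y]sub0r gB g00 sub0r opprK.
have gle x y : x <= y -> g x <= g y.
  by rewrite opos_sub (opos_sub (g x)) -gB; apply: g0.
pose P := [set p | OI A p /\ g p = 0].
have P0 : P 0 by split => //; apply: OI0.
have Psub : P `<=` OI A by move=> p [].
have [s [[sOI sub] slub]] : exists s, sup_in (OI A) P s.
  apply: ded => //; first by exists 0.
  by exists 1; split; [apply: OI1|move=> p [/OI_le1]].
exists s; split=> //; last by move=> p pOI gp; apply: sub.
pose I := {p : A | P p}.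
pose leI (i j : I) := projT1 i <= projT1 j.
have dir : directed leI.
  split=> //.
  - by constructor; exists 0.
  - by move=> i; rewrite /leI.
  - by move=> i j k; apply: le_trans.
  - move=> [p pP] [q qP]; case: (pP) (qP) => pOI gp [qOI gq].
    have jP : P (p + q - p * q).
      split; first exact: OI_join.
      apply/le_anti/andP; split.
        rewrite gB gD gp gq addr0 sub0r -oppr0; apply: oleN; apply: g0.
        by apply: oposM; apply: OI_ge0.
      by apply/g0/OI_ge0/OI_join.
    exists (exist _ _ jP); rewrite /leI /=.
    rewrite !(opos_sub _ (p + q - _)); split.
      rewrite [p + q]addrC addrAC addrK.
      have -> : q - p * q = (1 - p) * q by rewrite mulrBl mul1r.
      by apply: oposM; [rewrite -opos_sub OI_le1|rewrite OI_ge0].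
    rewrite addrAC addrK.
    have -> : p - p * q = p * (1 - q) by rewrite mulrBr mulr1.
    by apply: oposM; [rewrite OI_ge0|rewrite -opos_sub OI_le1].
have [] := gc I leI (fun i => s - projT1 i) dir.
  split.
  - by move=> [p [pOI gp]] /=; apply: OI_sub => //; apply: sub.
  - by move=> i j ij; apply: oleD => //; apply: oleN.
  - split.
      split; first exact: OI0.
      by move=> _ [[p [pOI gp]] _ <-] /=; rewrite -opos_sub; apply: sub.
    move=> q [qOI qlb].
    have qs : q <= s.
      by have := qlb _ (imageT _ (exist _ 0 P0 : I)); rewrite /= subr0.
    suff : s <= s - q by rewrite opos_sub (opos_sub q) addrAC subrr.
    apply: slub; split; first exact: OI_sub.
    move=> p pP; have := qlb _ (imageT _ (exist _ p pP : I)) => /= h.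
    by rewrite opos_sub addrAC -opos_sub.
move=> _ _ [_ ginf]; apply/le_anti/andP; split; last by apply/g0/OI_ge0.
apply: ginf; split=> // _ [[p [pOI gp]] _ <-] /=.
by rewrite gB gp subr0.
Qed.

End OrderIdempotents.

Section Irreducible.
Context (R : realType) (A : orderedBanachAlgebra R) (hA1 : axiom_A1 A).
Implicit Types (a b c p q x y z : A) (l : R).

Lemma largest_left_annihilator b : order_continuous b ->
  exists s, [/\ OI A s, s * b = 0 & forall p, OI A p -> p * b = 0 -> p <= s].
Proof.
move=> [b0 bc]; have [_ _ ded _] := hA1.
apply: (@largest_annihilator _ _ (fun p => p * b)) => //.
- by move=> x y; rewrite mulrBl.
- by move=> x x0; apply: oposM.
- by move=> I leI p dir pd; have [] := bc I leI p dir pd.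
Qed.

Lemma largest_right_annihilator b : order_continuous b ->
  exists s, [/\ OI A s, b * s = 0 & forall p, OI A p -> b * p = 0 -> p <= s].
Proof.
move=> [b0 bc]; have [_ _ ded _] := hA1.
apply: (@largest_annihilator _ _ (fun p => b * p)) => //.
- by move=> x y; rewrite mulrBr.
- by move=> x x0; apply: oposM.
- by move=> I leI p dir pd; have [] := bc I leI p dir pd.
Qed.

Lemma mul_OI_continuous p b : OI A p -> order_continuous b ->
  order_continuous (p * b) /\ order_continuous (b * p).
Proof.
move=> hp bc; have p0 := OI_ge0 hp; have p1 := OI_le1 hp; have [b0 _] := bc.
split; apply: (order_continuous_le _ _ bc); try exact: oposM.
- by rewrite -[leRHS]mul1r; apply: oleM2r.
- by rewrite -[leRHS]mulr1; apply: oleM2l.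
Qed.

(** With s the largest idempotent such that s b = 0, also (s a) b = 0, and the
    disjunctive product gives s a q = 0 with 1 - q <= s.  Hence s a (1 - s) = 0, and
    irreducibility leaves s = 0 or s = 1, the latter being excluded by b <> 0. *)
Lemma irreducible_left_faithful a b (l : R[i]) : order_continuous a ->
  irreducible a -> order_continuous b -> b != 0 -> a * b = l *: b ->
  forall p, OI A p -> p * b = 0 -> p = 0.
Proof.
move=> ac [_ irr] bc bn0 ab; have [_ disj _ _] := hA1.
have [s [sOI sb smax]] := largest_left_annihilator bc.
have sab : s * a * b = 0 by rewrite -mulrA ab -scalerAr sb scaler0.
have [sac _] := mul_OI_continuous sOI ac.
have [q qOI [saq qb]] := disj _ _ sac bc sab.
have qs : 1 - q <= s by apply: smax => //; apply: OI_complement.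
have s'q : q * (1 - s) = 1 - s.
  apply: OI_le_mulr => //; first exact: OI_complement.
  by move: qs; rewrite (opos_sub _ s) (opos_sub _ q) !opprB addrCA.
have := irr (1 - s) (OI_complement sOI).
rewrite subKr -s'q mulrA saq mul0r => /(_ erefl)[/eqP|/eqP].
  rewrite s'q subr_eq0 => /eqP s1.
  by move: sb bn0; rewrite -s1 mul1r => ->; rewrite eqxx.
rewrite s'q => /eqP s1 p pOI pb.
have s0 : s = 0 by rewrite -(subKr 1 s) s1 subrr.
by apply/le_anti; rewrite OI_ge0 // andbT -s0; apply: smax.
Qed.

Lemma irreducible_right_faithful a b (l : R[i]) : order_continuous a ->
  irreducible a -> order_continuous b -> b != 0 -> b * a = l *: b ->
  forall p, OI A p -> b * p = 0 -> p = 0.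
Proof.
move=> ac [_ irr] bc bn0 ba; have [_ disj _ _] := hA1.
have [s [sOI bs smax]] := largest_right_annihilator bc.
have bas : b * (a * s) = 0 by rewrite mulrA ba -scalerAl bs scaler0.
have [_ asc] := mul_OI_continuous sOI ac.
have [q qOI [bq qas]] := disj _ _ bc asc bas.
have qs : q <= s by apply: smax.
have s'q : (1 - s) * (1 - q) = 1 - s.
  by rewrite mulrBr mulr1 [X in _ - X]mulrBl mul1r OI_le_mulr // subrr subr0.
have := irr s sOI; rewrite -s'q -!mulrA qas mulr0 => /(_ erefl)[] s01 p pOI bp.
  by apply/le_anti; rewrite OI_ge0 // andbT -s01; apply: smax.
by move: bs bn0; rewrite s01 mulr1 => ->; rewrite eqxx.
Qed.

(** If p b q = 0 with q <> 0, then b q <> 0 is again an eigenvector of a, and p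
    annihilates it from the left. *)
Lemma irreducible_strictly_positive a b (l : R[i]) : order_continuous a ->
  irreducible a -> order_continuous b -> b != 0 ->
  a * b = l *: b -> b * a = l *: b -> strictly_positive b.
Proof.
move=> ac irr bc bn0 ab ba p q pOI qOI p0 q0.
have b0 : 0 <= b by case: bc.
have pbq0 : 0 <= p * b * q by apply: oposM (OI_ge0 qOI); apply: oposM (OI_ge0 pOI) b0.
rewrite lt_def pbq0 andbT.
apply/eqP => pbq; have [_ bqc] := mul_OI_continuous qOI bc.
have bq0 : b * q != 0.
  apply/eqP => /(irreducible_right_faithful ac irr bc bn0 ba qOI) q00.
  by move: q0; rewrite q00 ltxx.
have abq : a * (b * q) = l *: (b * q) by rewrite mulrA ab scalerAl.
have := irreducible_left_faithful ac irr bqc bq0 abq pOI.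
by rewrite mulrA => /(_ pbq) p00; move: p0; rewrite p00 ltxx.
Qed.

Lemma strictly_positive_left b p : strictly_positive b -> OI A p ->
  p * b = 0 -> p = 0.
Proof.
move=> bs pOI pb; apply: contrapT => /eqP p0.
have p0' : 0 < p by rewrite lt_def p0 OI_ge0.
by have := bs p 1 pOI (@OI1 R A) p0' (@olt01 R A); rewrite pb mul0r ltxx.
Qed.

Lemma strictly_positive_right b p : strictly_positive b -> OI A p ->
  b * p = 0 -> p = 0.
Proof.
move=> bs pOI pb; apply: contrapT => /eqP p0.
have p0' : 0 < p by rewrite lt_def p0 OI_ge0.
by have := bs 1 p (@OI1 R A) pOI (@olt01 R A) p0'; rewrite mul1r pb ltxx.
Qed.

Lemma strictly_positive_sqr b : order_continuous b -> strictly_positive b ->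
  b * b <> 0.
Proof.
move=> bc bs bb; have [_ disj _ _] := hA1.
have [q qOI [/(strictly_positive_right bs qOI) q0]] := disj _ _ bc bc bb.
rewrite q0 subr0 mul1r => b0; have := strictly_positive_left bs (@OI1 R A).
by rewrite mul1r => /(_ b0)/eqP; rewrite oner_eq0.
Qed.

(** A strictly positive b has no nontrivial annihilating order idempotent, so the
    disjunctive product allows b to be cancelled, first on the left of y b and then on
    the right of y. *)
Lemma strictly_positive_sandwich b y : order_continuous b ->
  strictly_positive b -> order_continuous y -> b * y * b = 0 -> y = 0.
Proof.
move=> bc bs yc byb; have [reg disj _ _] := hA1.
rewrite -mulrA in byb.
have [q qOI [/(strictly_positive_right bs qOI) q0]] :=
  disj _ _ bc (reg _ _ yc bc) byb.
rewrite q0 subr0 mul1r => yb.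
have [p pOI [yp]] := disj _ _ yc bc yb.
move/(strictly_positive_left bs (OI_complement pOI))/eqP.
by rewrite subr_eq0 => /eqP p1; rewrite -p1 mulr1 in yp.
Qed.

End Irreducible.

(** * Laurent expansions *)

Section RootsOfUnity.
Context (R : realType).

(** A 2^K-th root of -1 has order exactly 2^(K+1). *)
Lemma prim_root_pow2_exists K : exists x : R[i], (2 ^ K.+1).-primitive_root x.
Proof.
have p0 : (0 < 2 ^ K)%N by rewrite expn_gt0.
pose x : R[i] := (2 ^ K).-root (-1).
have xK : x ^+ (2 ^ K) = -1 by apply: rootCK.
have xK1 : x ^+ (2 ^ K.+1) = 1 by rewrite expnSr exprM xK sqrrN expr1n.
have [m mx mK] := prim_order_exists (expn_gt0 2 K.+1) xK1.
exists x; move: mK mx => /(dvdn_pfactor _ _ (isT : prime 2))[j jK ->] mx.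
move: jK; rewrite leq_eqVlt => /orP[/eqP <-//|]; rewrite ltnS => jK.
have /prim_expr_order : (2 ^ j).-primitive_root x by [].
move=> h; have : x ^+ (2 ^ K) = 1.
  by rewrite -(subnKC jK) expnD exprM h expr1n.
rewrite xK => /esym/eqP; rewrite -subr_eq0 opprK.
by rewrite (_ : 1 + 1 = 2%:R) // pnatr_eq0.
Qed.

Lemma sum_powers_unity (x : R[i]) N : x ^+ N = 1 -> x != 1 ->
  \sum_(l < N) x ^+ l = 0.
Proof.
move=> xN x1; apply/eqP; have := subrX1 x N.
rewrite xN subrr => /esym/eqP; rewrite mulf_eq0 subr_eq0 (negbTE x1) /=.
by [].
Qed.

End RootsOfUnity.

Section Laurent.
Context (R : realType) (A : orderedBanachAlgebra R).
Implicit Types (u d : int -> A) (f : R[i] -> A) (z w : R[i]).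

Lemma nrm_lim_le (u : nat -> A) (x : A) M : (forall n, nrm (u n) <= M) ->
  u @ \oo --> x -> nrm x <= M.
Proof.
move=> uM /cvg_nrmP/cvgrPdist_lt ux; apply/ler_addgt0Pr => e e0.
have [n _ /(_ n (leqnn n))] := ux e e0.
rewrite /= sub0r normrN => /(le_lt_trans (ler_norm _)) h.
rewrite -[x](subKr (u n)); apply: (le_trans (nrmD _ _)).
by rewrite nrmN; apply: lerD; [apply: uM|apply: ltW].
Qed.

Lemma cvg_bounded (u : nat -> A) (x : A) : u @ \oo --> x ->
  exists M, forall n, nrm (u n) <= M.
Proof.
move=> /cvg_nrmP/cvgrPdist_lt/(_ 1 ltr01)[N _ hN].
exists (\sum_(i < N) nrm (u i) + (1 + nrm x)) => n.
have S0 : 0 <= \sum_(i < N) nrm (u i) by apply: sumr_ge0 => i _; apply: nrm_ge0.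
have [nN|nN] := ltnP n N.
  rewrite (bigD1 (Ordinal nN)) //= -addrA lerDl addr_ge0 //.
    by apply: sumr_ge0 => i _; apply: nrm_ge0.
  by rewrite addr_ge0 // nrm_ge0.
have /= := hN n nN; rewrite sub0r normrN => /(le_lt_trans (ler_norm _)) h.
rewrite ler_wpDl // -[u n](subrK x); apply: (le_trans (nrmD _ _)).
by rewrite lerD2r ltW.
Qed.

Lemma series_terms_bounded (v : nat -> A) (x : A) : series v @ \oo --> x ->
  exists M, forall n, nrm (v n) <= M.
Proof.
by move=> /cvgP/cvg_series_cvg_0/cvg_bounded.
Qed.

Lemma laurent_near f z0 u : laurent_expansion f z0 u ->
  exists2 e : R, 0 < e &
    forall z, z != z0 -> nmc (z - z0) < e -> laurent_sum u z0 z (f z).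
Proof.
move=> /nbhs_ballP[[e e']] /=; rewrite ltcE /= => /andP[/eqP -> e0] h.
exists e => // z zz0 ze; apply: h => //.
by rewrite /ball /= distrC nmcE ltcR.
Qed.

(** Convergence at the point z1 bounds the terms there; at points at most half as far
    from the centre the terms then decay geometrically. *)
Lemma laurent_regular_bound u z0 z1 s1 :
  laurent_sum u z0 z1 s1 -> exists C : R,
  forall z, 2 * nmc (z - z0) <= nmc (z1 - z0) ->
  forall n : nat, nrm ((z - z0) ^+ n *: u n%:Z) <= C * (1 / 2) ^+ n.
Proof.
move=> [v [_ [/series_terms_bounded[C hC] _ _]]]; exists C => z' hz m.
apply: (le_trans _ (ler_wpM2r _ (hC m))); last by rewrite exprn_ge0 // divr_ge0.
rewrite !nrmZ mulrAC ler_wpM2r ?nrm_ge0 // !nmcX -exprMn.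
by apply: lerXn2r; rewrite ?nnegrE ?mulr_ge0 ?nmc_ge0 ?divr_ge0 //; lra.
Qed.

(** The same in powers of 1 / (z - z0): now the terms decay at points at least twice as
    far from the centre. *)
Lemma laurent_principal_bound u z0 z1 s1 : z1 != z0 ->
  laurent_sum u z0 z1 s1 -> exists C : R,
  forall z, 2 * nmc (z1 - z0) <= nmc (z - z0) ->
  forall n : nat, nrm ((z - z0) ^- n.+1 *: u (- n.+1%:Z)) <= C * (1 / 2) ^+ n.
Proof.
move=> z10 [_ [v [_ /series_terms_bounded[C hC] _]]]; exists C => z' hz m.
have C0 : 0 <= C by apply: le_trans (hC 0); apply: nrm_ge0.
apply: (@le_trans _ _ (C * (1 / 2) ^+ m.+1)); last first.
  by apply: ler_wpM2l => //; rewrite exprS ler_piMl ?exprn_ge0 //; lra.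
apply: (le_trans _ (ler_wpM2r _ (hC m))); last by rewrite exprn_ge0 // divr_ge0.
rewrite !nrmZ mulrAC ler_wpM2r ?nrm_ge0 // !nmcV !nmcX -!exprVn -exprMn.
have p1 : 0 < nmc (z1 - z0) by rewrite lt_def nmc_eq0 subr_eq0 z10 nmc_ge0.
have p2 : 0 < nmc (z' - z0) by lra.
apply: lerXn2r; rewrite ?nnegrE ?mulr_ge0 ?invr_ge0 ?nmc_ge0 //.
by rewrite mul1r -invfM lef_pV2 ?posrE ?mulr_gt0 // mulrC.
Qed.

(** On the circle of radius e/4 a truncation g of the expansion is uniformly small.  Its
    average against w over the N-th roots of unity, with N larger than all exponents,
    isolates the coefficient of 1/w; this is a discrete Cauchy integral. *)
Lemma laurent_zero d z0 (e : R) : 0 < e ->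
  (forall z, z != z0 -> nmc (z - z0) < e -> laurent_sum d z0 z 0) ->
  d (- 1) = 0.
Proof.
move=> e0 h.
pose pt (s : R) : R[i] := z0 + s%:C.
have ptE (s : R) : 0 < s -> nmc (pt s - z0) = s.
  by move=> s0; rewrite /pt addrAC subrr add0r nmcR gtr0_norm.
have pt0 (s : R) : 0 < s -> pt s != z0.
  by move=> s0; rewrite -subr_eq0 -nmc_eq0 ptE // gt_eqF.
have e2 : 0 < e / 2 by lra. have e4 : 0 < e / 4 by lra.
have e8 : 0 < e / 8 by lra.
(* The expansion converges at the radii e/2 and e/8, so that at the radius e/4 the terms
   of both of its parts decay like 2^-n. *)
have [C1 hC1] : exists C : R, forall z, 2 * nmc (z - z0) <= nmc (pt (e / 2) - z0) ->
  forall n : nat, nrm ((z - z0) ^+ n *: d n%:Z) <= C * (1 / 2) ^+ n.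
  apply: (laurent_regular_bound (s1 := 0)).
  by apply: h; rewrite ?ptE ?pt0 //; lra.
have [C2 hC2] : exists C : R,  forall z, 2 * nmc (pt (e / 8) - z0) <= nmc (z - z0) ->
  forall n : nat, nrm ((z - z0) ^- n.+1 *: d (- n.+1%:Z)) <= C * (1 / 2) ^+ n.
  apply: (laurent_principal_bound (s1 := 0) (pt0 _ e8)) => //.
  by apply: h; rewrite ?ptE ?pt0 //; lra.
rewrite ptE // in hC1; rewrite ptE // in hC2.
have hf0 : (0 : R) <= 1 / 2 by lra. have hf1 : (1 / 2 : R) < 1 by lra.
pose C := 2 * (C1 + C2).
pose g M w := \sum_(0 <= n < M) w ^+ n *: d n%:Z +
              \sum_(0 <= n < M) w ^- n.+1 *: d (- n.+1%:Z).
have tail (v : nat -> A) x (K : R) M : series v @ \oo --> x ->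
    (forall n, nrm (v n) <= K * (1 / 2) ^+ n) ->
    nrm (x - \sum_(0 <= n < M) v n) <= 2 * K * (1 / 2) ^+ M.
  move=> vx vK; apply: (@nrm_lim_le (fun k => series v (k + M)%N - series v M)).
    move=> k; rewrite addnC sub_series_geq; last first.
      exact: leq_addr.
    have := geometric_majorant_tail M k hf0 hf1 vK; congr (_ <= _ * _).
    by field.
  by apply: cvgB; [rewrite (cvg_shiftn M (series v))|apply: cvg_cst].
have gsmall M w : nmc w = e / 4 -> nrm (g M w) <= C * (1 / 2) ^+ M.
  move=> we; pose z := z0 + w; have zw : z - z0 = w by rewrite /z addrAC subrr add0r.
  have zz0 : z != z0 by rewrite -subr_eq0 zw -nmc_eq0 we gt_eqF.
  have [|v1 [v2 [h1 h2 v12]]] := h z zz0; first by rewrite zw we; lra.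
  rewrite zw in h1 h2.
  have b1 : forall n : nat, nrm (w ^+ n *: d n%:Z) <= C1 * (1 / 2) ^+ n.
    by move=> n; rewrite -zw; apply: hC1; rewrite zw we; lra.
  have b2 : forall n : nat, nrm (w ^- n.+1 *: d (- n.+1%:Z)) <= C2 * (1 / 2) ^+ n.
    by move=> n; rewrite -zw; apply: hC2; rewrite zw we; lra.
  rewrite -nrmN -[- g M w]add0r [X in X - _]v12 /g opprD addrACA.
  apply: (le_trans (nrmD _ _)); rewrite /C mulrDr mulrDl.
  by apply: lerD; apply: tail.
have key M : (0 < M)%N -> nrm (d (-1)) <= e / 4 * (C * (1 / 2) ^+ M).
  move=> M0; have [x xN] := prim_root_pow2_exists R M.
  set N := (2 ^ M.+1)%N in xN.
  have MN : (M < N)%N by rewrite /N expnS; have := ltn_expl M (isT : 1 < 2)%N; lia.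
  have N0 : (0 < N)%N by apply: leq_ltn_trans MN.
  have x1 : nmc x = 1.
    have := nmcX x N; rewrite (prim_expr_order xN) nmcR normr1 => /esym/eqP.
    by rewrite pexpr_eq1 ?nmc_ge0 // => /eqP.
  have x0 : x != 0 by rewrite -nmc_eq0 x1 oner_neq0.
  pose rho : R[i] := (e / 4)%:C.
  have rho0 : rho != 0 by rewrite -nmc_eq0 nmcR gt_eqF // normr_gt0 gt_eqF.
  have avg : \sum_(l < N) x ^+ l *: g M (rho * x ^+ l) = (N%:R * rho^-1) *: d (-1).
    rewrite /g; under eq_bigr do rewrite scalerDr !scaler_sumr.
    rewrite big_split /= exchange_big [X in _ + X]exchange_big /=.
    have pw j : (0 < j)%N -> (j < N)%N -> \sum_(l < N) (x ^+ j) ^+ l = 0.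
      move=> j0 jN; apply: sum_powers_unity.
        by rewrite exprAC (prim_expr_order xN) expr1n.
      by rewrite -(prim_order_dvd xN) gtnNdvd.
    rewrite big_nat big1 ?add0r => [|n /andP[_ nM]]; last first.
      transitivity ((rho ^+ n * \sum_(l < N) (x ^+ n.+1) ^+ l) *: d n%:Z).
        rewrite mulr_sumr scaler_suml; apply: eq_bigr => l _; rewrite scalerA.
        by congr (_ *: _); rewrite exprMn mulrCA -exprS exprAC.
      by rewrite pw ?mulr0 ?scale0r // (leq_ltn_trans nM).
    rewrite -(prednK M0) big_nat_recl //= [X in _ + X]big_nat [X in _ + X]big1 ?addr0 => [|n /andP[_ nM]].
      transitivity ((\sum_(l < N) rho^-1) *: d (-1)).
        rewrite scaler_suml; apply: eq_bigr => l _; rewrite scalerA.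
        rewrite expr1 invfM mulrCA mulfV ?mulr1 //.
        by rewrite expf_eq0 (negbTE x0) andbF.
      by rewrite sumr_const card_ord mulr_natl.
    transitivity ((rho ^- n.+2 * \sum_(l < N) (x ^+ n.+1) ^- l) *: d (- n.+2%:Z)).
      rewrite mulr_sumr scaler_suml; apply: eq_bigr => l _; rewrite scalerA.
      congr (_ *: _); rewrite exprMn invfM mulrCA; congr (_ * _).
      rewrite (exprS (x ^+ l) n.+1) invfM mulrA mulfV ?mul1r 1?exprAC //.
      by rewrite expf_eq0 (negbTE x0) andbF.
    have pwV : \sum_(l < N) (x ^+ n.+1) ^- l = 0.
      under eq_bigr do rewrite -exprVn; apply: sum_powers_unity.
        by rewrite exprVn exprAC (prim_expr_order xN) expr1n invr1.
      rewrite invr_eq1 -(prim_order_dvd xN) gtnNdvd //.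
      by apply: leq_ltn_trans MN; lia.
    by rewrite pwV mulr0 scale0r.
  have : nrm (\sum_(l < N) x ^+ l *: g M (rho * x ^+ l)) <= N%:R * (C * (1 / 2) ^+ M).
    apply: (le_trans (nrm_sum _ _ _)).
    rewrite mulr_natl -[in leRHS](card_ord N) -sumr_const.
    apply: ler_sum => l _; rewrite nrmZ nmcX x1 expr1n mul1r; apply: gsmall.
    by rewrite nmcM nmcX x1 expr1n mulr1 nmcR gtr0_norm.
  rewrite avg nrmZ nmcM nmcV nmcR (gtr0_norm e4).
  have -> : nmc (N%:R : R[i]) = N%:R by rewrite -(rmorph_nat (real_complex R)) nmcR ger0_norm.
  rewrite -mulrA ler_pM2l ?ltr0n // mulrC ler_pdivrMr // => hle.
  by rewrite mulrC.
apply: nrm_eq0; apply/le_anti; rewrite nrm_ge0 andbT.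
have cv : (fun M => e / 4 * C * (1 / 2) ^+ M.+1) @ \oo --> (0 : R).
  rewrite (cvg_shiftS (fun M => e / 4 * C * (1 / 2) ^+ M)).
  exact: cvg_geometric_majorant.
apply: (ler_cvg_to (cvg_cst _) cv); apply: nearW => M /=.
by rewrite -mulrA; apply: key.
Qed.

(** Laurent expansions are unique, so the choice in [residue] is immaterial. *)
Lemma residueE f z0 u : laurent_expansion f z0 u -> residue f z0 = u (- 1).
Proof.
move=> fu; rewrite /residue; apply: xget_subset1; first by exists u.
move=> _ _ [u1 h1 ->] [u2 h2 ->]; apply/eqP; rewrite -subr_eq0; apply/eqP.
have [e1 e10 {}h1] := laurent_near h1; have [e2 e20 {}h2] := laurent_near h2.
apply: (@laurent_zero (fun n => u1 n - u2 n) z0 (Num.min e1 e2)).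
  by rewrite lt_min e10.
move=> z zz0; rewrite lt_min => /andP[ze1 ze2].
have [v1 [w1 [hv1 hw1 s1]]] := h1 z zz0 ze1.
have [v2 [w2 [hv2 hw2 s2]]] := h2 z zz0 ze2.
have seriesB (x y : nat -> A) (c : nat -> R[i]) :
    series (fun n => c n *: (x n - y n)) =
    (fun n => series (fun n => c n *: x n) n - series (fun n => c n *: y n) n).
  apply/funext => n; rewrite /series /= -sumrB; apply: eq_bigr => i _.
  by rewrite scalerBr.
exists (v1 - v2), (w1 - w2); split.
- by rewrite seriesB; apply: cvgB.
- rewrite (seriesB (fun n => u1 (- n.+1%:Z)) (fun n => u2 (- n.+1%:Z))).
  exact: cvgB.
- by rewrite addrACA -opprD -s1 -s2 subrr.
Qed.

Lemma cvg_sum_nat0 (F : nat -> nat -> A) m :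
  (forall j, (j < m)%N -> F j @ \oo --> (0 : A)) ->
  (fun n => \sum_(0 <= j < m) F j n) @ \oo --> (0 : A).
Proof.
elim: m => [|m IH] hF.
  by under eq_fun do rewrite big_geq //; exact: cvg_cst.
under eq_fun do rewrite big_nat_recr //=.
have h1 : (fun n => \sum_(0 <= j < m) F j n) @ \oo --> (0 : A).
  by apply: IH => j jm; apply: hF; apply: ltnW.
have h : (fun n => \sum_(0 <= j < m) F j n + F m n) @ \oo --> (0 + 0 : A).
  by apply: cvgD => //; apply: hF.
by rewrite addr0 in h.
Qed.

(** The principal part has at most k terms, of which only the last survives
    multiplication by (z - z0)^k; the regular part stays bounded. *)
Lemma laurent_pole_lim f z0 u (k : nat) (z : nat -> R[i]) : (0 < k)%N ->
  laurent_expansion f z0 u -> (forall n : int, n < - k%:Z -> u n = 0) ->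
  (forall n, z n != z0) -> (fun n => nmc (z n - z0)) @ \oo --> (0 : R) ->
  (fun n => (z n - z0) ^+ k *: f (z n)) @ \oo --> u (- k%:Z).
Proof.
move=> k0 /laurent_near[e e0 h] uk zz0 zlim.
have e2 : 0 < e / 2 by lra.
pose z1 := z0 + (e / 2)%:C.
have z1E : nmc (z1 - z0) = e / 2.
  by rewrite /z1 addrAC subrr add0r nmcR gtr0_norm.
have z10 : z1 != z0 by rewrite -subr_eq0 -nmc_eq0 z1E gt_eqF.
have [|C hC] := laurent_regular_bound (h z1 z10 _); first by rewrite z1E; lra.
have hf0 : (0 : R) <= 1 / 2 by lra. have hf1 : (1 / 2 : R) < 1 by lra.
pose p n := \sum_(0 <= j < k) (z n - z0) ^+ (k.-1 - j) *: u (- j.+1%:Z).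
have zlimX j : (fun n => nmc (z n - z0) ^+ j.+1) @ \oo --> (0 : R).
  elim: j => [//|j IH]; under eq_fun do rewrite exprS.
  have -> : (0 : R) = 0 * 0 by rewrite mulr0.
  exact: cvgM.
have pk : p @ \oo --> u (- k%:Z).
  pose q n := \sum_(0 <= j < k.-1) (z n - z0) ^+ (k.-1 - j) *: u (- j.+1%:Z).
  have q0 : q @ \oo --> (0 : A).
    apply: cvg_sum_nat0 => j jk.
    apply: (@cvg_nrm_le _ _ _ _ (fun n => nmc (z n - z0) ^+ (k.-1 - j.+1).+1 *
       nrm (u (- j.+1%:Z)))).
      have -> : (0 : R) = 0 * nrm (u (- j.+1%:Z)) by rewrite mul0r.
      by apply: cvgM; [exact: zlimX|exact: cvg_cst].
    apply: nearW => n; rewrite subr0 nrmZ nmcX.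
    by have -> : (k.-1 - j = (k.-1 - j.+1).+1)%N by lia.
  have pE : p = (fun n => q n + u (- k%:Z)).
    by apply/funext => n; rewrite /p /q -[in LHS](prednK k0) big_nat_recr //= subnn expr0 scale1r prednK.
  have : p @ \oo --> 0 + u (- k%:Z) by rewrite pE; apply: cvgD => //; exact: cvg_cst.
  by rewrite add0r.
(* [p] is (z - z0)^k times the principal part. *)
have diff0 : (fun n => (z n - z0) ^+ k *: f (z n) - p n) @ \oo --> (0 : A).
  apply: (@cvg_nrm_le _ _ _ _ (fun n => nmc (z n - z0) ^+ k * (2 * C))).
    have -> : (0 : R) = 0 * (2 * C) by rewrite mul0r.
    by apply: cvgM; [rewrite -(prednK k0)|apply: cvg_cst].
  have /cvgrPdist_lt/(_ (e / 4))[|N _ hN] := zlim; first by lra.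
  exists N => // n /hN /=; rewrite sub0r normrN => /(le_lt_trans (ler_norm _)) zn.
  rewrite subr0; have [|v [w [hv hw ->]]] := h (z n) (zz0 n); first lra.
  set y := z n - z0 in hv hw zn *.
  have y0 : y != 0 by rewrite subr_eq0.
  have -> : y ^+ k *: (v + w) - p n = y ^+ k *: v.
    rewrite scalerDr -addrA (_ : _ - p n = 0) ?addr0 //.
    have -> : w = \sum_(0 <= j < k) y ^- j.+1 *: u (- j.+1%:Z).
      apply: (cvg_seq_unique hw); apply: cvg_near_cst.
      exists k => // m /= km; rewrite /series /= (big_cat_nat _ (n := k)) //=.
      rewrite [X in _ + X]big_nat [X in _ + X]big1 ?addr0 // => j /andP[kj _].
      by rewrite uk ?scaler0 //; lia.
    rewrite scaler_sumr /p -sumrB big_nat big1 // => j /andP[_ jk].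
    have -> : (k.-1 - j = k - j.+1)%N by lia.
    have -> : y ^+ k = y ^+ (k - j.+1) * y ^+ j.+1 by rewrite -exprD subnK.
    by rewrite scalerA mulfK ?expf_neq0 // subrr.
  rewrite nrmZ nmcX; apply: ler_wpM2l; first by rewrite exprn_ge0 // nmc_ge0.
  apply: (nrm_lim_le _ hv) => m; rewrite /series /= -[m]add0n.
  have hm i : nrm (y ^+ i *: u i%:Z) <= C * (1 / 2) ^+ i.
    by apply: hC; rewrite z1E -/y; lra.
  have := geometric_majorant_tail 0 m hf0 hf1 hm; rewrite expr0 mulr1.
  by congr (_ <= _); field.
have : (fun n => ((z n - z0) ^+ k *: f (z n) - p n) + p n) @ \oo --> 0 + u (- k%:Z).
  apply: cvgD => //; exact: diff0.
by rewrite add0r; under eq_fun do rewrite subrK.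
Qed.

End Laurent.

(** * Poles on the spectral circle *)

Section DominatedElements.
Context (R : realType) (A : orderedBanachAlgebra R) (a : A).
Implicit Types (b c : A).

Lemma coef_dominated_ge0 (P Q : {poly R[i]}) : coef_dominated P Q ->
  forall i, 0 <= Q`_i.
Proof. by move=> d i; apply: le_trans (d i). Qed.

(** The polynomials in [a] that converge to [b] have nonnegative coefficients. *)
Lemma dominated_order_continuous c b : axiom_A1 A -> order_continuous a ->
  dominated a c b -> order_continuous (a * b).
Proof.
move=> [reg _ _ ccl] ac [P [Q [d _ q]]].
have qq := cvg_mul (cvg_cst a) q.
apply: (closed_cvg _ ccl _ _ (qq _)); apply: nearW => n.
by apply: order_continuous_poly => //; apply: coef_dominated_ge0 (d n).
Qed.

Definition Re_poly (P : {poly R[i]}) := \poly_(i < size P) (complex.Re P`_i)%:C.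
Definition Im_poly (P : {poly R[i]}) := \poly_(i < size P) (complex.Im P`_i)%:C.

Lemma Re_polyE P i : (Re_poly P)`_i = (complex.Re P`_i)%:C.
Proof. by rewrite coef_poly; case: ltnP => // h; rewrite nth_default. Qed.

Lemma Im_polyE P i : (Im_poly P)`_i = (complex.Im P`_i)%:C.
Proof. by rewrite coef_poly; case: ltnP => // h; rewrite nth_default. Qed.

Lemma poly_Re_Im P : P = Re_poly P + 'i *: Im_poly P.
Proof.
apply/polyP => i; rewrite coefD coefZ Re_polyE Im_polyE; case: P`_i => s t /=.
by apply/eqP; rewrite eq_complex /=; apply/andP; split; apply/eqP; ring.
Qed.

Lemma Re_poly_le P Q i : coef_dominated P Q -> - Q`_i <= (Re_poly P)`_i <= Q`_i.
Proof.
move=> /(_ i) d; rewrite -real_ler_norml; last first.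
  by rewrite Re_polyE complex_real.
apply: le_trans d; rewrite Re_polyE !nmcE nmcR lecR; exact: ler_Re_nmc.
Qed.

Lemma Im_poly_le P Q i : coef_dominated P Q -> - Q`_i <= (Im_poly P)`_i <= Q`_i.
Proof.
move=> /(_ i) d; rewrite -real_ler_norml; last first.
  by rewrite Im_polyE complex_real.
apply: le_trans d; rewrite Im_polyE !nmcE nmcR lecR; exact: ler_Im_nmc.
Qed.

Lemma horner_alg_le (P Q : {poly R[i]}) : 0 <= a -> 
  (forall i, - Q`_i <= P`_i <= Q`_i) ->
  - horner_alg a Q <= horner_alg a P <= horner_alg a Q.
Proof.
move=> a0 PQ; rewrite (opos_sub (- _)) (opos_sub (horner_alg a P)) opprK.
rewrite -rmorphD -rmorphB /=; apply/andP; split; apply: horner_alg_ge0 => // i.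
  by rewrite coefD; have /andP[+ _] := PQ i; rewrite -subr_ge0 opprK.
by rewrite coefB subr_ge0; have /andP[] := PQ i.
Qed.

Lemma regular_part_le (x b : A) : - b <= x <= b -> regular_part A x.
Proof.
move=> /andP[h1 h2]; exists (x + b), b; split.
- by move: h1; rewrite opos_sub opprK.
- have : 0 <= (1 / 2 : R)%:C *: (b + x + (b - x)).
    apply: oposZ; first by lra.
    by apply: oposD; [move: h1; rewrite opos_sub opprK addrC|rewrite -opos_sub].
  rewrite addrACA subrr addr0 scalerDr -scalerDl -rmorphD /=.
  have -> : 1 / 2 + 1 / 2 = 1 :> R by lra.
  by rewrite rmorph1 scale1r.
- by rewrite addrK.
Qed.

(** The real and imaginary parts of the approximating polynomials converge separately
    by axiom A5, and their bounds pass to the limit because the cone is closed. *)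
Lemma dominated_parts c b : axiom_A5 A -> 0 <= a -> dominated a c b ->
  exists x y, [/\ c = x + 'i *: y, - b <= x <= b & - b <= y <= b].
Proof.
move=> A5 a0 [P [Q [d p q]]].
pose X n := horner_alg a (Re_poly (P n)); pose Y n := horner_alg a (Im_poly (P n)).
have hX n : - horner_alg a (Q n) <= X n <= horner_alg a (Q n).
  by apply: horner_alg_le => // i; apply: Re_poly_le.
have hY n : - horner_alg a (Q n) <= Y n <= horner_alg a (Q n).
  by apply: horner_alg_le => // i; apply: Im_poly_le.
have PE : (fun n => horner_alg a (P n)) = (fun n => X n + 'i *: Y n).
  by apply/funext => n; rewrite {1}(poly_Re_Im (P n)) rmorphD /= horner_algZ.
rewrite PE in p.
have [|||cX cY] := A5 X Y.
- by move=> n; apply: regular_part_le (hX n).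
- by move=> n; apply: regular_part_le (hY n).
- by apply/cvg_ex; exists c.
exists (lim (X @ \oo)), (lim (Y @ \oo)); split.
- apply: (cvg_seq_unique p); apply: cvgD => //; exact: cvg_scale_seq.
- apply/andP; split; apply: ole_lim.
  + by move=> n; have /andP[h _] := hX n; apply: h.
  + by apply: cvgN; apply: q.
  + exact: cX.
  + by move=> n; have /andP[_ h] := hX n; apply: h.
  + exact: cX.
  + exact: q.
- apply/andP; split; apply: ole_lim.
  + by move=> n; have /andP[h _] := hY n; apply: h.
  + by apply: cvgN; apply: q.
  + exact: cY.
  + by move=> n; have /andP[_ h] := hY n; apply: h.
  + exact: cY.
  + exact: q.
Qed.

End DominatedElements.

Section Poles.
Context (R : realType) (A : orderedBanachAlgebra R) (a : A).
Implicit Types (b c h : A) (t z : R[i]).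

Local Notation r := (spectral_radius a).
Local Notation Rs := (resolvent a).

Context (r0 : 0 < r).

(** A radial sequence in the resolvent set that tends to the point r t of the spectral
    circle. *)
Definition ray t (n : nat) : R[i] := (r + r / n.+1%:R)%:C * t.

Lemma ray_gt n : r < r + r / n.+1%:R.
Proof. by rewrite ltrDl divr_gt0. Qed.

Lemma ray_sub t n : ray t n - r%:C * t = (r / n.+1%:R)%:C * t.
Proof. by rewrite -mulrBl -rmorphB /= addrAC subrr add0r. Qed.

Lemma nmc_ray_sub t n : nmc t = 1 -> nmc (ray t n - r%:C * t) = r / n.+1%:R.
Proof. by move=> t1; rewrite ray_sub nmcM t1 mulr1 nmcR gtr0_norm // divr_gt0. Qed.

Lemma ray_neq t n : nmc t = 1 -> ray t n != r%:C * t.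
Proof. by move=> t1; rewrite -subr_eq0 -nmc_eq0 nmc_ray_sub // gt_eqF // divr_gt0. Qed.

Lemma ray_cvg t : nmc t = 1 -> (fun n => nmc (ray t n - r%:C * t)) @ \oo --> (0 : R).
Proof.
move=> t1; under eq_fun do rewrite nmc_ray_sub //.
have -> : (0 : R) = r * 0 by rewrite mulr0.
by apply: cvgM; [exact: cvg_cst|exact: cvg_harmonic].
Qed.

Lemma ray_unit t n : nmc t = 1 -> (ray t n)%:A - a \is a GRing.unit.
Proof.
move=> t1; apply: resolvent_unit; rewrite nmcM t1 mulr1 nmcR gtr0_norm ?ray_gt //.
exact: lt_trans r0 (ray_gt n).
Qed.

Lemma cvg_scale (z : nat -> R[i]) z' (u : nat -> A) c :
  (fun n => nmc (z n - z')) @ \oo --> (0 : R) -> u @ \oo --> c ->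
  (fun n => z n *: u n) @ \oo --> z' *: c.
Proof.
move=> zz uc; have za : (fun n => (z n)%:A : A) @ \oo --> (z'%:A : A).
  apply: (@cvg_nrm_le _ _ _ _ (fun n => nmc (z n - z') * nrm (1 : A))).
    have -> : (0 : R) = 0 * nrm (1 : A) by rewrite mul0r.
    by apply: cvgM => //; apply: cvg_cst.
  by apply: nearW => n; rewrite -scalerBl nrmZ.
have := cvg_mul za uc; rewrite mulr_algl; congr (_ _).
by under eq_fun do rewrite mulr_algl.
Qed.

Lemma ray_pow_cvg t j (u : nat -> A) c : nmc t = 1 -> u @ \oo --> c ->
  (fun n => (ray t n - r%:C * t) ^+ j.+1 *: u n) @ \oo --> (0 : A).
Proof.
move=> t1 uc; rewrite -(scale0r c); apply: cvg_scale uc.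
elim: j => [|j IH].
  by under eq_fun do rewrite subr0 expr1; apply: ray_cvg.
have -> : (0 : R) = 0 * 0 by rewrite mulr0.
under eq_fun do rewrite subr0 exprS nmcM.
by apply: cvgM; [apply: ray_cvg|under eq_fun do rewrite -[_ ^+ _]subr0].
Qed.

Lemma resolvent_mull z : z%:A - a \is a GRing.unit -> a * Rs z = z *: Rs z - 1.
Proof.
move=> zU; have := mulrV zU; rewrite -/(Rs z) mulrBl mulr_algl => <-.
by rewrite opprB addrC subrK.
Qed.

Lemma resolvent_mulr z : z%:A - a \is a GRing.unit -> Rs z * a = z *: Rs z - 1.
Proof.
move=> zU; have := mulVr zU; rewrite -/(Rs z) mulrBr mulr_algr => <-.
by rewrite opprB addrC subrK.
Qed.

Lemma resolvent_eigenl z z' h : z%:A - a \is a GRing.unit ->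
  a * h = z' *: h -> (z - z') *: (Rs z * h) = h.
Proof.
move=> zU ah; rewrite scalerAr scalerBl -ah -[z *: h]mulr_algl -mulrBl.
by rewrite mulKr.
Qed.

Lemma resolvent_eigenr z z' h : z%:A - a \is a GRing.unit ->
  h * a = z' *: h -> (z - z') *: (h * Rs z) = h.
Proof.
move=> zU ah; rewrite scalerAl scalerBl -ah -[z *: h]mulr_algr -mulrBr.
by rewrite mulrK.
Qed.

(** The eigenvalue equations are the limits of
    a R(z) = R(z) a = z R(z) - 1 after multiplication by (z - r t)^k. *)
Lemma pole_coefficient t k : nmc t = 1 -> (0 < k)%N ->
  resolvent_pole_of_order a (r%:C * t) k -> exists c : A,
  [/\ c != 0,
      (fun n => (ray t n - r%:C * t) ^+ k *: Rs (ray t n)) @ \oo --> c,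
      a * c = (r%:C * t) *: c, c * a = (r%:C * t) *: c
    & k = 1 -> residue Rs (r%:C * t) = c].
Proof.
move=> t1 k0 [_ [u [hu uk ul]]]; exists (u (- k%:Z)).
have lim := laurent_pole_lim k0 hu ul (fun n => ray_neq n t1) (ray_cvg t1).
have lim0 : (fun n => (ray t n - r%:C * t) ^+ k *: (1 : A)) @ \oo --> (0 : A).
  by rewrite -(prednK k0); apply: ray_pow_cvg => //; apply: cvg_cst.
have limz : (fun n => ray t n *: ((ray t n - r%:C * t) ^+ k *: Rs (ray t n)) -
    (ray t n - r%:C * t) ^+ k *: (1 : A)) @ \oo --> (r%:C * t) *: u (- k%:Z) - 0.
  by apply: cvgB => //; apply: cvg_scale => //; apply: ray_cvg.
rewrite subr0 in limz.
split=> //; last by move=> k1; rewrite (residueE hu) k1.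
- apply: (cvg_seq_unique (cvg_mul (cvg_cst a) lim)).
  under eq_fun do rewrite -scalerAr resolvent_mull ?ray_unit // scalerBr scalerA mulrC -scalerA.
  exact: limz.
- apply: (cvg_seq_unique (cvg_mul lim (cvg_cst a))).
  under eq_fun do rewrite -scalerAl resolvent_mulr ?ray_unit // scalerBr scalerA mulrC -scalerA.
  exact: limz.
Qed.

Lemma dominated_ray t k n : nmc t = 1 ->
  dominated a ((ray t n - r%:C * t) ^+ k *: Rs (ray t n))
              ((ray 1 n - r%:C * 1) ^+ k *: Rs (ray 1 n)).
Proof.
move=> t1; have nt := nmc_ray_sub n t1.
have -> : (ray 1 n - r%:C * 1) ^+ k = (nmc ((ray t n - r%:C * t) ^+ k))%:C.
  by rewrite nmcX nt rmorphXn /= ray_sub mulr1.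
apply: dominatedZ; rewrite /ray mulr1; apply: dominated_resolvent => //.
  exact: lt_trans r0 (ray_gt n).
exact: ray_gt.
Qed.

Context (hA1 : axiom_A1 A) (hA5 : axiom_A5 A).
Context (ac : order_continuous a) (irr : irreducible a).
Context (ra_pole : resolvent_pole a r%:C).

(** Since a b = r b, one has R(z) b = b / (z - r), so that
    (z - r)^k R(z) b = (z - r)^(k-1) b.  In the limit b b = 0 if k > 1, which strict
    positivity excludes, and b b = b if k = 1. *)
Lemma spectral_projection : exists b : A,
  [/\ [/\ order_continuous b, strictly_positive b & b * b = b],
      a * b = r%:C *: b /\ b * a = r%:C *: b,
      (fun n => (ray 1 n - r%:C * 1) *: Rs (ray 1 n)) @ \oo --> b
    & residue Rs r%:C = b].
Proof.
have n1 : nmc (1 : R[i]) = 1 by rewrite /nmc normr1.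
have [k k0 pk] := ra_pole; rewrite -[r%:C]mulr1 in pk.
have [b [b0 lim ab ba res]] := pole_coefficient n1 k0 pk.
rewrite mulr1 in ab ba res.
have a0 : 0 <= a by case: ac.
have db : dominated a b b.
  by apply: (dominated_lim _ lim lim) => n; apply: dominated_ray.
(* Only a b is a limit of order continuous elements; but b = a b / r. *)
have bc : order_continuous b.
  have := order_continuousZ (ltW (_ : 0 < r^-1)) (dominated_order_continuous hA1 ac db).
  rewrite invr_gt0 ab scalerA -rmorphM mulVf ?gt_eqF // scale1r; exact.
have bs := irreducible_strictly_positive hA1 ac irr bc b0 ab ba.
have limb := cvg_mul lim (cvg_cst b).
have E n : ((ray 1 n - r%:C * 1) ^+ k *: Rs (ray 1 n)) * b =
           (ray 1 n - r%:C * 1) ^+ k.-1 *: b.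
  rewrite -{1}(prednK k0) exprSr -scalerA -!scalerAl.
  by rewrite mulr1 resolvent_eigenl // ray_unit.
have k1 : k = 1%N.
  case: k k0 pk lim res limb E => [//|[//|k]] _ _ _ _ limb E.
  case: (strictly_positive_sqr hA1 bc bs).
  apply: (cvg_seq_unique (limb _)); under eq_fun do rewrite E /=.
  by apply: ray_pow_cvg => //; apply: cvg_cst.
subst k; exists b; split=> //; last exact: res.
split=> //; apply: (cvg_seq_unique (limb _)).
by under eq_fun do rewrite E /= expr0 scale1r; apply: cvg_cst.
Qed.

End Poles.

(** * Markov operators on C(K) *)

Section States.
Context (R : realType) (K : topologicalType).
Implicit Types (g h u v : K -> R) (l : R).

(** Evaluation at a point, after a Markov operator on C(K), is such a functional. *)
Definition state (L : (K -> R) -> R) : Prop :=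
  [/\ forall l g h, continuous g -> continuous h ->
        L (fun t => l * g t + h t) = l * L g + L h,
      forall g, continuous g -> (forall t, 0 <= g t) -> 0 <= L g
    & L (fun=> 1) = 1].

Lemma continuous_cst l : continuous (fun _ : K => l).
Proof. by move=> t; apply: cvg_cst. Qed.

Lemma continuous_mul g h : continuous g -> continuous h ->
  continuous (fun t => g t * h t).
Proof. by move=> gc hc t; apply: cvgM; [apply: gc|apply: hc]. Qed.

Lemma continuous_sqr g : continuous g -> continuous (fun t => g t ^+ 2).
Proof.
by move=> gc; under eq_fun do rewrite expr2; apply: continuous_mul.
Qed.

Lemma continuous_comb l g h : continuous g -> continuous h ->
  continuous (fun t => l * g t + h t).
Proof.
move=> gc hc t; apply: cvgD; [apply: cvgM|apply: hc]; [exact: cvg_cst|exact: gc].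
Qed.

Context (L : (K -> R) -> R) (hL : state L).

Lemma stateD g h : continuous g -> continuous h ->
  L (fun t => g t + h t) = L g + L h.
Proof.
move=> gc hc; have [lin _ _] := hL; have := lin 1 g h gc hc.
by under eq_fun do rewrite mul1r; rewrite mul1r.
Qed.

(** The variance L ((u - L u)^2) is nonnegative. *)
Lemma state_sqr u : continuous u -> L u ^+ 2 <= L (fun t => u t ^+ 2).
Proof.
move=> uc; have [lin pos one] := hL.
have u2c : continuous (fun t => u t ^+ 2).
  exact: continuous_sqr.
pose w t := - (2 * L u) * u t + (L u ^+ 2 * 1 + u t ^+ 2).
have wc : continuous w.
  by do 2?apply: continuous_comb => //; apply: continuous_cst.
have : 0 <= L w.
  apply: pos => // t; have -> : w t = (u t - L u) ^+ 2 by rewrite /w; ring.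
  exact: sqr_ge0.
rewrite /w lin //; last by apply: continuous_comb => //; apply: continuous_cst.
rewrite lin //; last exact: continuous_cst.
by rewrite one; lra.
Qed.

(** With p = L u and q = L v, the function 1 - p u - q v, which is
    ((u - p)^2 + (v - q)^2) / 2, is annihilated by L.  So L ((u - p)^2) = 0, and by the
    Cauchy-Schwarz inequality L ((u - p) g) = 0. *)
Lemma state_eigen_mult u v g : continuous u -> continuous v -> continuous g ->
  (forall t, u t ^+ 2 + v t ^+ 2 = 1) -> L u ^+ 2 + L v ^+ 2 = 1 ->
  L (fun t => u t * g t) = L u * L g.
Proof.
move=> uc vc gc uv Luv; have [lin pos one] := hL.
set p := L u; set q := L v.
have gg : continuous (fun t => g t * g t) by apply: continuous_mul.
have ug : continuous (fun t => u t * g t) by apply: continuous_mul.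
have Z := continuous_cst.
set D := L (fun t => u t * g t) - p * L g.
suff hD s : 0 <= 2 * s * D + L (fun t => g t * g t).
  suff : D = 0 by rewrite /D => /subr0_eq.
  apply/eqP; apply: contraT => D0.
  set C := L (fun t => g t * g t) in hD *.
  have := hD (- (C + 1) / (2 * D)).
  have -> : 2 * (- (C + 1) / (2 * D)) * D = - (C + 1) by field.
  by lra.
(* [w] equals (s (u - p) + g)^2 + (s (v - q))^2, and L w is affine in s: a slope
   D <> 0 would contradict L w >= 0. *)
pose w t := 2 * s ^+ 2 * (1 - p * u t - q * v t) + 2 * s * ((u t - p) * g t) + g t * g t.
have wE : w = (fun t => (- (2 * s ^+ 2 * p)) * u t + ((- (2 * s ^+ 2 * q)) * v t +
   ((2 * s ^+ 2) * 1 + ((2 * s) * (u t * g t) + ((- (2 * s * p)) * g t + g t * g t))))).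
  by apply/funext => t; rewrite /w; ring.
have c1 := continuous_comb (l := - (2 * s * p)) gc gg.
have c2 := continuous_comb (l := 2 * s) ug c1.
have c3 := continuous_comb (l := 2 * s ^+ 2) (Z 1) c2.
have c4 := continuous_comb (l := - (2 * s ^+ 2 * q)) vc c3.
have c5 := continuous_comb (l := - (2 * s ^+ 2 * p)) uc c4.
have : 0 <= L w.
  apply: pos; first by rewrite wE.
  move=> t; have := uv t; have := Luv; rewrite -/p -/q => h1 h2.
  have -> : w t = (s * (u t - p) + g t) ^+ 2 + (s * (v t - q)) ^+ 2.
    have -> : w t = (s * (u t - p) + g t) ^+ 2 + (s * (v t - q)) ^+ 2
       + s ^+ 2 * ((1 - (p ^+ 2 + q ^+ 2)) + (1 - (u t ^+ 2 + v t ^+ 2))).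
      by rewrite /w; ring.
    by rewrite h1 h2; ring.
  by rewrite addr_ge0 // sqr_ge0.
rewrite wE !lin // one -/p -/q.
suff -> : - (2 * s ^+ 2 * p) * p + (- (2 * s ^+ 2 * q) * q + (2 * s ^+ 2 * 1 +
   (2 * s * L (fun t => u t * g t) + (- (2 * s * p) * L g + L (fun t => g t * g t))))) =
   2 * s * D + L (fun t => g t * g t) by [].
have := Luv; rewrite -/p -/q => h1.
transitivity (2 * s ^+ 2 * (1 - (p ^+ 2 + q ^+ 2)) + (2 * s * D + L (fun t => g t * g t))).
  by rewrite /D; ring.
by rewrite h1; ring.
Qed.

End States.

Section Representation.
Context (R : realType) (A : orderedBanachAlgebra R) (b : A).
Context (K : topologicalType) (f : A -> K -> R).
Context (b_ge0 : 0 <= b) (iso : lattice_iso_CK b f).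
Implicit Types (x y : A) (l : R) (g h u v : K -> R) (S : A -> A) (z : R[i]).

Local Notation J := (order_ideal b).

Lemma ideal_self : J b.
Proof.
exists 1 => //; rewrite rmorph1 scale1r lexx andbT.
by rewrite opos_sub opprK oposD.
Qed.

Lemma ideal_comb x y : J x -> J y -> forall l, J (l%:C *: x + y).
Proof.
move=> + + l; have absC : l%:C = `|l|%:C \/ l%:C = - `|l|%:C.
  have [h|h] := lerP 0 l; first by left; rewrite ger0_norm.
  by right; rewrite ltr0_norm // rmorphN opprK.
move=> [m m0 /andP[mx xm]] [n n0 /andP[ny yn]].
exists (`|l| * m + n); first by rewrite addr_ge0 // mulr_ge0.
have lx : - ((`|l| * m)%:C *: b) <= l%:C *: x <= (`|l| * m)%:C *: b.
  rewrite rmorphM /= -scalerA.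
  have h1 := oleZ2 (normr_ge0 l) mx; have h2 := oleZ2 (normr_ge0 l) xm.
  rewrite scalerN in h1.
  case: absC => ->; first by rewrite h1 h2.
  rewrite scaleNr; apply/andP; split; first exact: oleN.
  by have := oleN h1; rewrite opprK.
have /andP[lx1 lx2] := lx.
rewrite rmorphD /= scalerDl opprD; apply/andP; split; exact: oleD.
Qed.

Lemma ideal0 : J 0.
Proof. by exists 0 => //; rewrite scale0r oppr0 lexx. Qed.

Lemma repr_comb x y : J x -> J y ->
  forall l, f (l%:C *: x + y) = (fun t => l * f x t + f y t).
Proof. by move=> xJ yJ l; case: iso => _ h _ _ _; apply: h. Qed.

Lemma repr_inj x y : J x -> J y -> f x = f y -> x = y.
Proof. by move=> xJ yJ; case: iso => -[_ inj _] _ _ _ _; apply: inj; rewrite inE. Qed.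

Lemma repr_continuous x : J x -> continuous (f x).
Proof. by case: iso => -[fun_ _ _] _ _ _ _ xJ; apply: (fun_ x). Qed.

Lemma repr0 : f 0 = (fun=> 0).
Proof.
have := repr_comb ideal0 ideal0 1; rewrite scaler0 addr0 => h.
apply/funext => t; have := congr1 (fun g => g t) h => /= /eqP.
by rewrite mul1r -subr_eq0 opprD addNKr oppr_eq0 => /eqP.
Qed.

Lemma repr_one : f b = (fun=> 1).
Proof. by case: iso. Qed.

Lemma repr_ge0 x : J x -> (0 <= x) <-> (forall t, 0 <= f x t).
Proof.
move=> xJ; have [_ _ sup _ _] := iso.
have [s [[sJ sub] slub] fs] := sup x 0 xJ ideal0; rewrite repr0 in fs; split=> x0.
  have sx : s = x.
    apply/le_anti/andP; split; last by apply: sub; left.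
    by apply: slub; split=> // _ [->|->].
  by move=> t; rewrite -sx fs le_max lexx orbT.
have fsx : f s = f x by apply/funext => t; rewrite fs; apply/max_idPl.
by rewrite -(repr_inj sJ xJ fsx); apply: sub; right.
Qed.

(** The inverse of the isomorphism [f], as a total function. *)
Definition lift g : A := xget 0 [set x | J x /\ f x = g].

Lemma liftP g : continuous g -> J (lift g) /\ f (lift g) = g.
Proof.
move=> gc; have [[_ _ surj] _ _ _ _] := iso.
have [x xJ fx] := surj g gc; rewrite /lift.
by apply: (@xgetPex _ 0 [set x | J x /\ f x = g]); exists x.
Qed.

Lemma liftE x : J x -> lift (f x) = x.
Proof.
move=> xJ; have [lJ lf] := liftP (repr_continuous xJ); exact: repr_inj.
Qed.

Lemma lift_comb l g h : continuous g -> continuous h ->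
  lift (fun t => l * g t + h t) = l%:C *: lift g + lift h.
Proof.
move=> gc hc; have [gJ gf] := liftP gc; have [hJ hf] := liftP hc.
have [lJ lf] := liftP (continuous_comb (l := l) gc hc).
by apply: repr_inj => //; [apply: ideal_comb|rewrite lf repr_comb // gf hf].
Qed.

(** In C(K) this is a positive linear operator that fixes the constant 1. *)
Definition markov S : Prop :=
  [/\ forall l x y, S (l%:C *: x + y) = l%:C *: S x + S y,
      forall x, 0 <= x -> 0 <= S x & S b = b].

Lemma markov_ideal S x : markov S -> J x -> J (S x).
Proof.
move=> [lin pos one] [m m0 /andP[mx xm]]; exists m => //.
have S0 : S 0 = 0.
  by have := lin (-1) 0 0; rewrite scaler0 addr0 rmorphN1 scaleN1r addNr.
have Sle (y w : A) : y <= w -> S y <= S w.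
  rewrite opos_sub (opos_sub (S y)) => /pos.
  by rewrite addrC -scaleN1r -(rmorphN1 (real_complex R)) lin /= rmorphN1 scaleN1r addrC.
have Sb l : S (l%:C *: b) = l%:C *: b.
  by have := lin l b 0; rewrite !addr0 S0 addr0 one.
apply/andP; split; last by rewrite -Sb; apply: Sle.
by rewrite -scaleNr -rmorphN -Sb /=; apply: Sle; rewrite rmorphN scaleNr.
Qed.

Lemma markov_state S t : markov S -> state (fun g => f (S (lift g)) t).
Proof.
move=> mS; have [lin pos one] := mS; split.
- move=> l g h gc hc; have [gJ _] := liftP gc; have [hJ _] := liftP hc.
  by rewrite lift_comb // lin repr_comb //; apply: markov_ideal.
- move=> g gc g0; have [gJ gf] := liftP gc.
  apply: (repr_ge0 (markov_ideal mS gJ)).1; apply: pos.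
  by apply/(repr_ge0 gJ); rewrite gf.
- by rewrite -repr_one liftE ?one ?repr_one //; apply: ideal_self.
Qed.

(** The equation S (x + iy) = z (x + iy), for S commuting with i. *)
Definition rotates S (z : R[i]) x y : Prop :=
  S x = (complex.Re z)%:C *: x - (complex.Im z)%:C *: y /\
  S y = (complex.Im z)%:C *: x + (complex.Re z)%:C *: y.

Definition unimodular_eigen S (z : R[i]) (u v : K -> R) : Prop :=
  [/\ continuous u, continuous v, forall t, u t ^+ 2 + v t ^+ 2 = 1
    & forall t, f (S (lift u)) t = complex.Re z * u t - complex.Im z * v t /\
                f (S (lift v)) t = complex.Im z * u t + complex.Re z * v t].

Lemma rotates_repr S z x y t : J x -> J y -> rotates S z x y ->
  f (S x) t = complex.Re z * f x t - complex.Im z * f y t /\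
  f (S y) t = complex.Im z * f x t + complex.Re z * f y t.
Proof.
move=> xJ yJ [-> ->].
have yJ' : J (- (complex.Im z)%:C *: y).
  by have := ideal_comb yJ ideal0 (- complex.Im z); rewrite addr0 rmorphN.
have yJ2 : J ((complex.Re z)%:C *: y).
  by have := ideal_comb yJ ideal0 (complex.Re z); rewrite addr0.
have E l : f (l%:C *: y) t = l * f y t.
  have := repr_comb yJ ideal0 l; rewrite addr0 repr0 => ->; ring.
rewrite -scaleNr !repr_comb //; split; first by rewrite -rmorphN E /=; ring.
by rewrite E.
Qed.

(** At each point the eigenfunction u1 + i v1 is multiplicative for S. *)
Lemma unimodular_eigenM S z1 z2 u1 v1 u2 v2 : markov S ->
  nmc z1 = 1 ->
  unimodular_eigen S z1 u1 v1 -> unimodular_eigen S z2 u2 v2 ->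
  unimodular_eigen S (z1 * z2) (fun t => (- 1) * (v1 t * v2 t) + u1 t * u2 t)
                               (fun t => 1 * (v1 t * u2 t) + u1 t * v2 t).
Proof.
move=> mS z11 [u1c v1c uv1 e1] [u2c v2c uv2 e2].
have c11 := continuous_mul u1c u2c; have c12 := continuous_mul u1c v2c.
have c21 := continuous_mul v1c u2c; have c22 := continuous_mul v1c v2c.
split; try exact: continuous_comb.
  move=> t; have h1 := uv1 t; have h2 := uv2 t.
  transitivity ((u1 t ^+ 2 + v1 t ^+ 2) * (u2 t ^+ 2 + v2 t ^+ 2)); first by ring.
  by rewrite h1 h2 mulr1.
move=> t; have st := markov_state t mS; have [lin _ _] := st.
have [eu1 ev1] := e1 t; have [eu2 ev2] := e2 t.
have zz : complex.Re z1 ^+ 2 + complex.Im z1 ^+ 2 = 1 by rewrite -nmc_sqr z11 expr1n.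
have n1 : f (S (lift u1)) t ^+ 2 + f (S (lift v1)) t ^+ 2 = 1.
  rewrite eu1 ev1; transitivity ((complex.Re z1 ^+ 2 + complex.Im z1 ^+ 2) *
    (u1 t ^+ 2 + v1 t ^+ 2)); first by ring.
  by rewrite zz uv1 mulr1.
have n2 : f (S (lift v1)) t ^+ 2 + f (S (lift u1)) t ^+ 2 = 1 by rewrite addrC.
have vu1 t' : v1 t' ^+ 2 + u1 t' ^+ 2 = 1 by rewrite addrC.
rewrite !lin // (state_eigen_mult st u1c v1c u2c uv1 n1)
  (state_eigen_mult st u1c v1c v2c uv1 n1)
  (state_eigen_mult st v1c u1c u2c vu1 n2)
  (state_eigen_mult st v1c u1c v2c vu1 n2) eu1 ev1 eu2 ev2.
case: z1 z2 {z11 zz e1 e2 n1 n2 eu1 ev1 eu2 ev2} => [s1 t1] [s2 t2] /=.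
by split; ring.
Qed.

Lemma unimodular_eigen_conj S z u v : markov S ->
  unimodular_eigen S z u v ->
  unimodular_eigen S z^* u (fun t => (- 1) * v t + 0).
Proof.
move=> mS [uc vc uv e]; have Z := @continuous_cst R K 0.
split=> //; first exact: continuous_comb.
  by move=> t; rewrite -[RHS](uv t); ring.
move=> t; have [lin _ _] := markov_state t mS; have [eu ev] := e t.
rewrite lin // eu ev (_ : f (S (lift (fun=> 0))) t = 0); last first.
  have [linS _ _] := mS.
  rewrite -repr0 liftE; last exact: ideal0.
  have -> : S 0 = 0 by have := linS (-1) 0 0; rewrite scaler0 addr0 rmorphN1 scaleN1r addNr.
  by rewrite repr0.
by case: z {e eu ev} => s s' /=; split; ring.
Qed.

Lemma unimodular_eigen_rotates S z u v : markov S -> unimodular_eigen S z u v ->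
  rotates S z (lift u) (lift v).
Proof.
move=> mS [uc vc uv e]; have [uJ uf] := liftP uc; have [vJ vf] := liftP vc.
have vJ' l : J (l%:C *: lift v).
  by have := ideal_comb vJ ideal0 l; rewrite addr0.
have E l t : f (l%:C *: lift v) t = l * v t.
  by have := repr_comb vJ ideal0 l; rewrite addr0 repr0 vf => ->; ring.
split; apply: repr_inj; try exact: markov_ideal.
- by rewrite -scaleNr -rmorphN /=; apply: (ideal_comb uJ (vJ' _)).
- apply/funext => t; rewrite (e t).1 -[in RHS]scaleNr -[in RHS]rmorphN /= repr_comb // uf E; ring.
- exact: (ideal_comb uJ (vJ' _)).
- by apply/funext => t; rewrite (e t).2 repr_comb // uf E.
Qed.

Lemma repr_point : b != 0 -> exists t : K, True.
Proof.
move=> b0; apply: contrapT => nK; move/eqP: b0; apply.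
apply: repr_inj; [exact: ideal_self|exact: ideal0|].
by apply/funext => t; case: nK; exists t.
Qed.

End Representation.

(** * Finite subgroups of the circle *)

Section CircleGroups.
Context (R : realType).
Implicit Types (z w : R[i]) (G : set R[i]).

Lemma ler_nmc_Re_Im z : nmc z <= `|complex.Re z| + `|complex.Im z|.
Proof.
rewrite -(@ler_pXn2r _ 2) ?nnegrE ?nmc_ge0 ?addr_ge0 // nmc_sqr sqrrD.
by rewrite !real_normK ?num_real // lerD2r lerDl mulrn_wge0 // mulr_ge0.
Qed.

Lemma circle_mul_conj z : nmc z = 1 -> z * z^* = 1.
Proof.
case: z => s t /(congr1 (fun x => x ^+ 2)); rewrite nmc_sqr expr1n /= => h.
by apply/eqP; rewrite eq_complex /= -h; apply/andP; split; apply/eqP; ring.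
Qed.

Lemma nmc_conj z : nmc z^* = nmc z.
Proof.
apply/eqP; rewrite -(@eqrXn2 _ 2) ?nmc_ge0 // !nmc_sqr.
by case: z => s t /=; rewrite sqrrN.
Qed.

Lemma truncn_close (x y : R) : 0 <= x -> 0 <= y ->
  Num.truncn x = Num.truncn y -> `|x - y| < 1.
Proof.
move=> /Num.Theory.truncn_itv /andP[x1 x2] /Num.Theory.truncn_itv /andP[y1 y2] xy.
rewrite xy in x1 x2; rewrite -natr1 in x2 y2.
by rewrite ltr_norml; apply/andP; split; lra.
Qed.

(** Pigeonhole on a grid: a cell of diameter less than e contains at most one point. *)
Lemma separated_circle_finite G (e : R) : 0 < e ->
  (forall z, G z -> nmc z = 1) ->
  (forall z w, G z -> G w -> nmc (z - w) < e -> z = w) -> finite_set G.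
Proof.
move=> e0 G1 Gsep.
(* Two points in the same cell of a grid of mesh 1/N are at distance less than
   2/N < e. *)
pose N := (Num.truncn (2 / e)).+1.
have N0 : 0 < N%:R :> R by rewrite ltr0n.
have Ne : 2 / N%:R < e.
  by rewrite ltr_pdivrMr // mulrC -ltr_pdivrMr // Num.Theory.truncnS_gt.
pose cell z := (Num.truncn ((complex.Re z + 1) * N%:R),
                Num.truncn ((complex.Im z + 1) * N%:R)).
have bnd z : G z -> [/\ 0 <= (complex.Re z + 1) * N%:R <= (2 * N)%:R &
                        0 <= (complex.Im z + 1) * N%:R <= (2 * N)%:R].
  move=> /G1 z1; have := ler_Re_nmc z; have := ler_Im_nmc z; rewrite z1 natrM.
  rewrite !ler_norml => /andP[h1 h2] /andP[h3 h4].
  have N0' := ltW N0.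
  split; apply/andP; split.
  - by apply: mulr_ge0 => //; lra.
  - by apply: ler_wpM2r => //; lra.
  - by apply: mulr_ge0 => //; lra.
  - by apply: ler_wpM2r => //; lra.
have inj : {in G &, injective cell}.
  move=> z w; rewrite !inE => zG wG [hR hI]; apply: Gsep => //.
  have [/andP[zR _] /andP[zI _]] := bnd z zG.
  have [/andP[wR _] /andP[wI _]] := bnd w wG.
  have shift (p q : R) : p + 1 - (q + 1) = p - q by ring.
  have := truncn_close zR wR hR; have := truncn_close zI wI hI.
  rewrite -!mulrBl !normrM !(gtr0_norm N0) -!ltr_pdivlMr // !shift => hIm hRe.
  apply: (le_lt_trans (ler_nmc_Re_Im _)).
  have {}hIm : `|complex.Im (z - w)| < 1 / N%:R by rewrite raddfB.
  have {}hRe : `|complex.Re (z - w)| < 1 / N%:R by rewrite raddfB.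
  apply: lt_trans Ne.
  have -> : 2 / N%:R = 1 / N%:R + 1 / N%:R :> R by rewrite -mulrDl.
  exact: ltrD.
have <- : finite_set (cell @` G) = finite_set G by apply/eq_finite_set/inj_card_eq.
apply: (@sub_finite_set _ _ (`I_(2 * N).+1 `*` `I_(2 * N).+1)); last first.
  by apply: finite_setX; apply: finite_II.
move=> _ [z /bnd[/andP[_ h1] /andP[_ h2]] <-]; split; rewrite /= ltnS.
  by rewrite -(@natrK R (2 * N)); apply: Num.Theory.le_truncn.
by rewrite -(@natrK R (2 * N)); apply: Num.Theory.le_truncn.
Qed.

(** Multiplication by an element z permutes the m elements, so comparing the products of
    all elements gives z^m = 1; and there are at most m roots of unity of exponent m. *)
Lemma finite_group_unity_roots G : finite_set G -> G 1 -> ~ G 0 ->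
  (forall z w, G z -> G w -> G (z * w)) ->
  exists2 m : nat, (1 <= m)%N & G = [set z | m.-unity_root z].
Proof.
move=> /finite_seqP[s0 Gs] G1 G0 GM.
pose s := undup s0; have us : uniq s by apply: undup_uniq.
have sG z : G z <-> z \in s by rewrite Gs mem_undup.
have m0 : (0 < size s)%N by case: (s) (sG 1) => [[/(_ G1)]|].
have root z : z \in s -> (size s).-unity_root z.
  move=> zs; have z0 : z != 0.
    by apply/eqP => z0; apply: G0; apply/sG; rewrite -z0.
  have pe : perm_eq [seq z * w | w <- s] s.
    have um : uniq [seq z * w | w <- s] by rewrite map_inj_uniq //; exact: mulfI.
    have sub : {subset [seq z * w | w <- s] <= s}.
      by move=> _ /mapP[w ws ->]; apply/sG; apply: GM; apply/sG.
    have [|_ mem] := uniq_min_size um sub; first by rewrite size_map.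
    exact: uniq_perm.
  have := perm_big _ pe (op := *%R) (x := 1) (P := xpredT) (F := id).
  rewrite big_map big_split /= big_const_seq count_predT iter_mulr_1 => h.
  have P0 : \prod_(w <- s) w != 0.
    rewrite prodf_seq_neq0; apply/allP => w ws /=.
    by apply/eqP => w0; apply: G0; apply/sG; rewrite -w0.
  apply/unity_rootP; apply: (mulIf P0); rewrite mul1r -[RHS]h; congr (_ * _).
exists (size s) => //; apply/seteqP; split => [z /sG/root//|z /= zr].
apply/sG; apply: contraT => zs.
have : all (size s).-unity_root (z :: s).
  by rewrite /= zr; apply/allP.
move=> /max_unity_roots; rewrite /= zs us => /(_ m0 isT).
by rewrite ltnn.
Qed.

End CircleGroups.

(** * Peripheral eigenvectors *)

Section ComplexScaling.
Context (R : realType) (A : orderedBanachAlgebra R).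

Lemma complexi_sqr : 'i * 'i = -1 :> R[i].
Proof. by rewrite -expr2 sqrCi. Qed.

Lemma complex_split (z : R[i]) : z = (complex.Re z)%:C + 'i * (complex.Im z)%:C.
Proof.
by case: z => s t /=; apply/eqP; rewrite eq_complex /=; apply/andP; split; apply/eqP; ring.
Qed.

Lemma complex_scale_parts (z : R[i]) (x y : A) :
  z *: (x + 'i *: y) = ((complex.Re z)%:C *: x - (complex.Im z)%:C *: y) +
    'i *: ((complex.Im z)%:C *: x + (complex.Re z)%:C *: y).
Proof.
rewrite {1}(complex_split z) scalerDl !scalerDr !scalerA.
rewrite mulrAC complexi_sqr mulN1r scaleNr [(complex.Re z)%:C * 'i]mulrC.
rewrite [X in _ + X = _]addrC addrACA; congr (_ + _); exact: addrC.
Qed.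

End ComplexScaling.

Section Peripheral.
Context (R : realType) (A : orderedBanachAlgebra R) (a b : A).
Local Notation r := (spectral_radius a).
Local Notation Rs := (resolvent a).
Context (hA1 : axiom_A1 A) (hA2 : axiom_A2 A) (hA4 : axiom_A4 A) (hA5 : axiom_A5 A).
Context (r0 : 0 < r) (a0 : 0 <= a) (bc : order_continuous b)
  (bs : strictly_positive b) (bb : b * b = b)
  (ab : a * b = r%:C *: b) (ba : b * a = r%:C *: b)
  (b_lim : (fun n => (ray a 1 n - r%:C * 1) *: Rs (ray a 1 n)) @ \oo --> b).
Context (K : topologicalType) (f : A -> K -> R) (iso : lattice_iso_CK b f).
Implicit Types (x y c h : A) (t z : R[i]) (u v : K -> R).
Local Notation J := (order_ideal b).

Let b_ge0 : 0 <= b. Proof. by case: bc. Qed.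

Let nmc1 : nmc (1 : R[i]) = 1. Proof. by rewrite /nmc normr1. Qed.

Lemma strictly_positive_neq0 : b != 0.
Proof.
apply/eqP => b0; apply: (strictly_positive_sqr hA1 bc bs).
by rewrite b0 mulr0.
Qed.

(** Along the ray to r t, the product (z - r t)^k R(z) is dominated by the
    corresponding product at r, which tends to b if k = 1, and to 0 if k > 1 as the
    pole at r is simple. *)
Lemma peripheral_coefficient t : nmc t = 1 -> resolvent_pole a (r%:C * t) ->
  exists c : A, [/\ c != 0, dominated a c b, a * c = (r%:C * t) *: c
                 & c * a = (r%:C * t) *: c].
Proof.
move=> t1 [k k0 pk]; have [c [c0 lim ac ca _]] := pole_coefficient r0 t1 k0 pk.
exists c; split=> //; case: k k0 pk lim => [//|[|k]] _ _ lim.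
  by apply: (dominated_lim _ lim b_lim) => n; apply: dominated_ray.
(* The leading coefficient at a pole of higher order would be dominated by 0. *)
have lim0 : (fun n => (ray a 1 n - r%:C * 1) ^+ k.+2 *: Rs (ray a 1 n)) @ \oo --> (0 : A).
  under eq_fun do rewrite exprSr -scalerA.
  exact: (ray_pow_cvg r0 k nmc1 b_lim).
have [|x [y [cxy]]] := dominated_parts hA5 a0 (c := c) (b := 0).
  by apply: (dominated_lim _ lim lim0) => n; apply: dominated_ray.
rewrite oppr0 => /le_anti x0 /le_anti y0.
by move: c0; rewrite cxy -x0 -y0 scaler0 addr0 eqxx.
Qed.

Definition left_mult y := (r^-1)%:C *: (a * y).
Definition right_mult y := (r^-1)%:C *: (y * a).

Lemma left_markov : markov b left_mult.
Proof.
split.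
- by move=> l x y; rewrite /left_mult mulrDr scalerDr -scalerAr scalerA mulrC -scalerA.
- by move=> x x0; apply: oposZ; [rewrite invr_ge0 ltW|apply: oposM].
- by rewrite /left_mult ab scalerA -rmorphM /= mulVf ?gt_eqF // scale1r.
Qed.

Lemma right_markov : markov b right_mult.
Proof.
split.
- by move=> l x y; rewrite /right_mult mulrDl scalerDr -scalerAl scalerA mulrC -scalerA.
- by move=> x x0; apply: oposZ; [rewrite invr_ge0 ltW|apply: oposM].
- by rewrite /right_mult ba scalerA -rmorphM /= mulVf ?gt_eqF // scale1r.
Qed.

Lemma ideal_regular x : J x -> regular_part A x.
Proof. by move=> [l _ h]; apply: regular_part_le h. Qed.

Lemma ideal_scale x (l : R) : J x -> J (l%:C *: x).
Proof. by move=> xJ; have := ideal_comb xJ (ideal0 b) l; rewrite addr0. Qed.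

Lemma ideal_sub x y : J x -> J y -> J (x - y).
Proof.
move=> xJ yJ; have := ideal_comb yJ xJ (-1).
by rewrite rmorphN1 scaleN1r addrC.
Qed.

Lemma ideal_add x y : J x -> J y -> J (x + y).
Proof.
by move=> xJ yJ; have := ideal_comb xJ yJ 1; rewrite scale1r.
Qed.

Lemma eigen_rotates S t x y : markov b S -> J x -> J y ->
  S x + 'i *: S y = t *: (x + 'i *: y) -> rotates S t x y.
Proof.
move=> mS xJ yJ; rewrite complex_scale_parts => /eqP.
rewrite -subr_eq0 opprD addrACA -scalerBr => /eqP /hA4[].
- apply: ideal_regular; apply: ideal_sub; first exact: markov_ideal.
  by apply: ideal_sub; apply: ideal_scale.
- apply: ideal_regular; apply: ideal_sub; first exact: markov_ideal.
  by apply: ideal_add; apply: ideal_scale.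
by move=> /subr0_eq e1 /subr0_eq e2.
Qed.

(** At a point k of K, with L = evaluation of S at k,
    L (x^2 + y^2) >= (L x)^2 + (L y)^2, and the right-hand side is |t|^2 (x^2 + y^2). *)
Lemma markov_modulus S t x y : markov b S -> J x -> J y -> nmc t = 1 ->
  rotates S t x y ->
  forall h, J h -> f h = (fun k => f x k ^+ 2 + f y k ^+ 2) -> 0 <= S h - h.
Proof.
move=> mS xJ yJ t1 rot h hJ fh.
apply/(repr_ge0 iso); first by apply: ideal_sub => //; apply: markov_ideal.
move=> k; rewrite addrC -scaleN1r -(rmorphN1 (real_complex R)) /=.
rewrite (repr_comb iso hJ (markov_ideal mS hJ)) mulN1r addrC subr_ge0.
have st := markov_state b_ge0 iso k mS.
have xc := repr_continuous iso xJ; have yc := repr_continuous iso yJ.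
have x2 : continuous (fun k => f x k ^+ 2).
  exact: continuous_sqr.
have y2 : continuous (fun k => f y k ^+ 2).
  exact: continuous_sqr.
rewrite -[X in S X](liftE iso hJ) fh (stateD st x2 y2).
apply: le_trans (lerD (state_sqr st xc) (state_sqr st yc)).
rewrite /= !(liftE iso) //; have [-> ->] := rotates_repr iso k xJ yJ rot.
have tt : complex.Re t ^+ 2 + complex.Im t ^+ 2 = 1 by rewrite -nmc_sqr t1 expr1n.
rewrite le_eqVlt; apply/orP; left; apply/eqP.
transitivity ((complex.Re t ^+ 2 + complex.Im t ^+ 2) * (f x k ^+ 2 + f y k ^+ 2)).
  by rewrite tt mul1r.
by ring.
Qed.

Lemma sandwich_eq0 x : 0 <= x -> J x -> b * x * b = 0 -> x = 0.
Proof.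
move=> x0 [l l0 /andP[_ xl]]; apply: (strictly_positive_sandwich hA1 bc bs).
exact: order_continuous_le xl (order_continuousZ l0 bc).
Qed.

Lemma fixed_left h : a * h = r%:C *: h -> b * h = h.
Proof.
move=> ah; apply: (cvg_seq_unique (cvg_mul b_lim (cvg_cst h))).
under eq_fun do rewrite -scalerAl mulr1 resolvent_eigenl ?ray_unit //.
exact: cvg_cst.
Qed.

Lemma fixed_right h : h * a = r%:C *: h -> h * b = h.
Proof.
move=> ha; apply: (cvg_seq_unique (cvg_mul (cvg_cst h) b_lim)).
under eq_fun do rewrite -scalerAr mulr1 resolvent_eigenr ?ray_unit //.
exact: cvg_cst.
Qed.

(** As b is the limit of (z - r) R(z), it fixes h on both sides; so h = b h b is a
    complex multiple of b, and the multiple is real because h is. *)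
Lemma fixed_scalar h : J h -> a * h = r%:C *: h -> h * a = r%:C *: h ->
  exists s : R, h = s%:C *: b.
Proof.
move=> hJ /fixed_left bh /fixed_right hb.
have : [set b * x * b | x in [set: A]] h by exists h => //; rewrite bh hb.
rewrite hA2 // => -[z _ zb]; exists (complex.Re z).
have := complex_split z; case: z zb => s s' /= zb sE.
have [] : h - s%:C *: b = 0 /\ (- s')%:C *: b = 0; last by move=> /subr0_eq.
apply: hA4.
- apply: ideal_regular; apply: ideal_sub => //; apply: ideal_scale.
  exact: ideal_self.
- by apply: ideal_regular; apply: ideal_scale; apply: ideal_self.
rewrite -zb sE scalerDl (addrC (s%:C *: b)) addrK scalerA -scalerDl -mulrDr.
by rewrite -rmorphD subrr rmorph0 mulr0 scale0r.
Qed.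

(** The modulus of the peripheral coefficient c is constant, so c may be normalized.
    Indeed h = |c|^2 satisfies a h >= r h and h a >= r h, and these are equalities
    because b (a h - r h) b = 0 = b (h a - r h) b. *)
Lemma peripheral_unimodular t : nmc t = 1 -> resolvent_pole a (r%:C * t) ->
  exists u v, unimodular_eigen b f left_mult t u v.
Proof.
move=> t1 /(peripheral_coefficient t1)[c [c0 cb ac ca]].
have [x [y [cxy xb yb]]] := dominated_parts hA5 a0 cb.
have xJ : J x by exists 1 => //; rewrite scale1r.
have yJ : J y by exists 1 => //; rewrite scale1r.
have lrot : rotates left_mult t x y.
  apply: eigen_rotates => //; first exact: left_markov.
  rewrite /left_mult -cxy scalerA mulrC -scalerA -scalerDr scalerAr -mulrDr -cxy ac.
  by rewrite scalerA mulrA -rmorphM /= mulVf ?gt_eqF // mul1r.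
have rrot : rotates right_mult t x y.
  apply: eigen_rotates => //; first exact: right_markov.
  rewrite /right_mult -cxy scalerA mulrC -scalerA -scalerDr scalerAl -mulrDl -cxy ca.
  by rewrite scalerA mulrA -rmorphM /= mulVf ?gt_eqF // mul1r.
have xc := repr_continuous iso xJ; have yc := repr_continuous iso yJ.
have hc : continuous (fun k => f x k ^+ 2 + f y k ^+ 2).
  by move=> k; apply: cvgD; apply: continuous_sqr.
have [hJ hf] := liftP iso hc; set h := lift b f _ in hJ hf.
have lh := markov_modulus left_markov xJ yJ t1 lrot hJ hf.
have rh := markov_modulus right_markov xJ yJ t1 rrot hJ hf.
have rK : r%:C * (r^-1)%:C = 1 by rewrite -rmorphM /= mulfV ?gt_eqF.
have ah : a * h = r%:C *: h.
  suff /subr0_eq e : left_mult h - h = 0.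
    by rewrite -[in RHS]e scalerA rK scale1r.
  apply: sandwich_eq0 => //.
    by apply: ideal_sub => //; apply: markov_ideal => //; apply: left_markov.
  rewrite mulrBr mulrBl /left_mult -scalerAr -scalerAl mulrA ba -!scalerAl scalerA.
  by rewrite mulrC rK scale1r subrr.
have ha : h * a = r%:C *: h.
  suff /subr0_eq e : right_mult h - h = 0.
    by rewrite -[in RHS]e scalerA rK scale1r.
  apply: sandwich_eq0 => //.
    by apply: ideal_sub => //; apply: markov_ideal => //; apply: right_markov.
  rewrite mulrBr mulrBl /right_mult -scalerAr -scalerAl -!mulrA ab -!scalerAr scalerA.
  by rewrite mulrC rK scale1r subrr.
have [s hs] := fixed_scalar hJ ah ha.
have xys k : f x k ^+ 2 + f y k ^+ 2 = s.
  have := repr_comb iso (ideal_self b_ge0) (ideal0 b) s.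
  rewrite addr0 -hs hf => /(congr1 (fun g => g k)) ->.
  by rewrite (repr0 iso) (repr_one iso); ring.
have [k0 _] := repr_point b_ge0 iso strictly_positive_neq0.
have s_ge0 : 0 <= s by rewrite -(xys k0) addr_ge0 ?sqr_ge0.
have s_neq0 : s != 0.
  apply/eqP => s0; move: c0; rewrite cxy.
  have sq0 k : f x k = 0 /\ f y k = 0.
    have /eqP := xys k; rewrite s0 paddr_eq0 ?sqr_ge0 // !sqrf_eq0.
    by move=> /andP[/eqP -> /eqP ->].
  have -> : x = 0.
    apply: (repr_inj iso xJ (ideal0 b)); rewrite (repr0 iso).
    by apply/funext => k; case: (sq0 k).
  have -> : y = 0.
    apply: (repr_inj iso yJ (ideal0 b)); rewrite (repr0 iso).
    by apply/funext => k; case: (sq0 k).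
  by rewrite scaler0 addr0 eqxx.
pose m := (Num.sqrt s)^-1.
have m2 : m ^+ 2 * s = 1 by rewrite exprVn sqr_sqrtr // mulVf.
pose x' := m%:C *: x; pose y' := m%:C *: y.
have x'J : J x' by apply: ideal_scale. have y'J : J y' by apply: ideal_scale.
have fx' k : f x' k = m * f x k.
  have := repr_comb iso xJ (ideal0 b) m; rewrite addr0 (repr0 iso) => ->; ring.
have fy' k : f y' k = m * f y k.
  have := repr_comb iso yJ (ideal0 b) m; rewrite addr0 (repr0 iso) => ->; ring.
have [lin _ _] := left_markov.
have L0 : left_mult 0 = 0 by rewrite /left_mult mulr0 scaler0.
have rot' : rotates left_mult t x' y'.
  have [e1 e2] := lrot; have ex := lin m x 0; have ey := lin m y 0.
  rewrite !addr0 L0 addr0 in ex; rewrite !addr0 L0 addr0 in ey.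
  rewrite /x' /y'; split.
    by rewrite ex e1 scalerBr !scalerA ![m%:C * _]mulrC.
  by rewrite ey e2 scalerDr !scalerA ![m%:C * _]mulrC.
exists (f x'), (f y'); split.
- exact: (repr_continuous iso).
- exact: (repr_continuous iso).
- move=> k; rewrite fx' fy' -m2 -(xys k); ring.
- by move=> k; rewrite (liftE iso x'J) (liftE iso y'J); exact: (rotates_repr iso k x'J y'J rot').
Qed.

Lemma unimodular_spectrum t u v : unimodular_eigen b f left_mult t u v ->
  spectrum a (r%:C * t).
Proof.
move=> uve; have [uc vc uv _] := uve.
have [e1 e2] := unimodular_eigen_rotates iso left_markov uve.
have [uJ uf] := liftP iso uc; have [vJ vf] := liftP iso vc.
set x := lift b f u in e1 e2 uJ uf; set y := lift b f v in e1 e2 vJ vf.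
have rK : r%:C * (r^-1)%:C = 1 by rewrite -rmorphM /= mulfV ?gt_eqF.
have ae : a * (x + 'i *: y) = (r%:C * t) *: (x + 'i *: y).
  have aE w : a * w = r%:C *: left_mult w by rewrite scalerA rK scale1r.
  rewrite aE -scalerA; congr (_ *: _); rewrite complex_scale_parts -e1 -e2.
  by rewrite /left_mult mulrDr scalerDr -scalerAr !scalerA ['i * _]mulrC.
apply/negP => tU.
have e0 : x + 'i *: y = 0.
  apply: (mulrI tU); rewrite mulr0 mulrBl ae.
  by rewrite mulr_algl subrr.
have [x0 y0] := hA4 (ideal_regular uJ) (ideal_regular vJ) e0.
have [k _] := repr_point b_ge0 iso strictly_positive_neq0.
have := uv k; rewrite -uf -vf x0 y0 (repr0 iso) expr0n addr0.
by move=> /eqP; rewrite eq_sym oner_eq0.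
Qed.

End Peripheral.

(** * The peripheral spectrum *)

Lemma isolated_ball (R : realType) (S : set R[i]) (z0 : R[i]) :
  isolated (S : set R[i]^o) z0 ->
  S z0 /\ exists2 e : R, 0 < e & forall z, S z -> nmc (z - z0) < e -> z = z0.
Proof.
move=> [/set_mem Sz0 [V /nbhs_ballP[[e e'] /=]]].
rewrite ltcE /= => /andP[/eqP -> e0] hV VS; split=> //; exists e => // z Sz zz0.
suff : [set z0] z by [].
rewrite -VS; split=> //; apply: hV; rewrite -ball_normE /= distrC.
by rewrite nmcE ltcR.
Qed.

Lemma peripheral_spectrumE (R : realType) (A : orderedBanachAlgebra R) (a : A) z :
  peripheral_spectrum a z <-> spectrum a z /\ nmc z = spectral_radius a.
Proof.
split=> -[zs zr]; split=> //; last by rewrite nmcE zr.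
by apply: complexI; rewrite -nmcE.
Qed.

Theorem theorem20 (R : realType) (A : orderedBanachAlgebra R)
  (hA1 : axiom_A1 A) (hA2 : axiom_A2 A) (hA3 : axiom_A3 A) (hA4 : axiom_A4 A)
  (hA5 : axiom_A5 A) (hALS : axiom_ALS' A)
  (a : A) (a_neq0 : a != 0) (a_cont : order_continuous a)
  (a_irr : irreducible a)
  (ra_pole : resolvent_pole a (spectral_radius a)%:C) :
  (forall z : R[i], peripheral_spectrum a z -> resolvent_pole a z) /\
  (exists m : nat, (1 <= m)%N /\
     peripheral_spectrum a =
       [set (spectral_radius a)%:C * z | z in [set z : R[i] | m.-unity_root z]]).
Proof.
set r := spectral_radius a in ra_pole *.
have [rs [e e0 re]] : spectrum a r%:C /\ exists2 e : R, 0 < e &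
    forall z, spectrum a z -> nmc (z - r%:C) < e -> z = r%:C.
  by case: ra_pole => k _ [/isolated_ball].
have r_ge0 : 0 <= r.
  by have := spectral_radius_ub rs; rewrite nmcR; apply: le_trans.
have [r0|r_neq0] := eqVneq r 0.
  have per0 z : peripheral_spectrum a z <-> z = 0.
    rewrite peripheral_spectrumE -/r r0; split=> [[_ /eqP]|->].
      by rewrite nmc_eq0 => /eqP.
    by rewrite r0 in rs; split=> //; apply/eqP; rewrite nmc_eq0.
  split=> [z /per0 ->|]; first by rewrite r0 in ra_pole.
  exists 1%N; split=> //; apply/seteqP; rewrite r0; split=> [z /per0 ->|z /=].
    by exists 1; [apply/unity_rootP; rewrite expr1n|rewrite mul0r].
  by move=> [w _ <-]; apply/per0; rewrite mul0r.
have r_gt0 : 0 < r by rewrite lt_def r_neq0.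
have rC : r%:C != 0 by rewrite -nmc_eq0 nmcR normr_eq0.
have a_ge0 : 0 <= a by case: a_cont.
have [b [[bc bs bb] [ab ba] b_lim res]] :=
  spectral_projection r_gt0 hA1 a_cont a_irr ra_pole.
have poles z : peripheral_spectrum a z -> resolvent_pole a z.
  by apply: hALS => //; rewrite -/r res.
split=> //.
have b_ge0 : 0 <= b by case: bc.
have [K [f [_ _ iso]]] := hA3 b b_ge0 (strictly_positive_neq0 hA1 bc bs).
have left_mk := left_markov r_gt0 a_ge0 ab.
pose G := [set t : R[i] | nmc t = 1 /\ spectrum a (r%:C * t)].
have G_eigen t : G t -> exists u v, unimodular_eigen b f (left_mult a) t u v.
  move=> [t1 ts]; apply: (peripheral_unimodular hA1 hA2 hA4 hA5 r_gt0 a_ge0) => //.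
  by apply: poles; apply/peripheral_spectrumE; rewrite nmcM t1 nmcR ger0_norm ?mulr1.
have eigen_G t u v : nmc t = 1 -> unimodular_eigen b f (left_mult a) t u v -> G t.
  move=> t1 uv; split=> //; exact: (unimodular_spectrum hA1 hA4 _ _ _ _ _ _ uv).
(* The elements t of [G] are exactly the eigenvalues of modulus 1 of left
   multiplication by a / r that have a unimodular eigenfunction. *)
have GM z w : G z -> G w -> G (z * w).
  move=> Gz Gw; have [u1 [v1 e1]] := G_eigen _ Gz; have [u2 [v2 e2]] := G_eigen _ Gw.
  have := unimodular_eigenM b_ge0 iso left_mk Gz.1 e1 e2.
  by apply: eigen_G; rewrite nmcM Gz.1 Gw.1 mulr1.
have GV z : G z -> G z^*.
  move=> Gz; have [u [v uv]] := G_eigen _ Gz.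
  have := unimodular_eigen_conj b_ge0 iso left_mk uv.
  by apply: eigen_G; rewrite nmc_conj Gz.1.
have G1 : G 1 by split; [rewrite /nmc normr1|rewrite mulr1].
have G0 : ~ G 0 by rewrite /G /= /nmc normr0 => -[/eqP]; rewrite eq_sym oner_eq0.
have Gfin : finite_set G.
  apply: (@separated_circle_finite _ _ (e / r)); first exact: divr_gt0.
    by move=> z [].
  move=> z w Gz Gw zw; have [w1 _] := Gw.
  have [_ zws] := GM _ _ Gz (GV _ Gw).
  have /(mulfI rC) : r%:C * (z * w^*) = r%:C * 1.
    rewrite mulr1; apply: re => //.
    have -> : r%:C * (z * w^*) - r%:C = r%:C * w^* * (z - w).
      by rewrite mulrBr -!mulrA [w^* * w]mulrC circle_mul_conj // mulr1 [w^* * z]mulrC.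
    rewrite !nmcM nmc_conj w1 mulr1 nmcR ger0_norm // mulrC.
    by rewrite -ltr_pdivlMr.
  move=> /(congr1 (fun x => x * w)).
  by rewrite mul1r -mulrA [_^* * w]mulrC circle_mul_conj // mulr1.
have [m m1 Gm] := finite_group_unity_roots Gfin G1 G0 GM.
exists m; split=> //; rewrite -Gm; apply/seteqP; split=> z.
  move/peripheral_spectrumE => [zs zr]; exists (z / r%:C); last by rewrite mulrC divfK.
  split; last by rewrite mulrC divfK.
  by rewrite nmcM nmcV zr nmcR ger0_norm // divff.
move=> [t [t1 ts] <-]; apply/peripheral_spectrumE; split=> //.
by rewrite nmcM t1 mulr1 nmcR ger0_norm.
Qed.
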